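(* Let $c\ge1$, let $(G,N)$ be a pair of finite groups and let $K$ be a central subgroup of $G$ contained in $N$. Let $F/R$ be a free presentation of $G$ and let $T$ be a normal subgroup of the free group $F$ such that $K=T/R$. Then: (i) $\displaystyle \frac{|K\cap[N,\,_cG]|}{|[K,\,_cG]|}\,|M^{(c)}(G,N)|$ divides $\displaystyle \left|M^{(c)}\!\left(\tfrac GK,\tfrac NK\right)\right|\;\left|\otimes^{c+1}\!\left(K,\tfrac GK\right)\right|\;\left|\frac{[R,\,_cF]\prod_{i=2}^{c+1}\gamma_{c+1}(T,F)_i}{[R,\,_cF]}\right|$; (ii) $\displaystyle d(M^{(c)}(G,N))\le d\!\left(M^{(c)}\!\left(\tfrac GK,\tfrac NK\right)\right)+d\!\left(\otimes^{c+1}\!\left(K,\tfrac GK\right)\right)+d\!\left(\frac{[R,\,_cF]\prod_{i=2}^{c+1}\gamma_{c+1}(T,F)_i}{[R,\,_cF]}\right)$; (iii) $\displaystyle \exp(M^{(c)}(G,N))$ divides $\displaystyle \exp\!\left(M^{(c)}\!\left(\tfrac GK,\tfrac NK\right)\right)\exp\!\left(\otimes^{c+1}\!\left(K,\tfrac GK\right)\right)\exp\!\left(\frac{[R,\,_cF]\prod_{i=2}^{c+1}\gamma_{c+1}(T,F)_i}{[R,\,_cF]}\right)$.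
   Context: A pair of groups $(G,N)$ is a group $G$ with a normal subgroup $N$. Commutators are left-normed: $[D_1,\dots,D_k]=[[D_1,\dots,D_{k-1}],D_k]$, $[X,\,_0F]=X$ and $[X,\,_{k+1}F]=[[X,\,_kF],F]$. For a pair $(G,N)$ and $c\ge1$, take a free presentation $1\to R\to F\to G\to 1$ ($F$ free; one writes $G\cong F/R$) and let $S\le F$ be the preimage of $N$, so that $N\cong S/R$. The $c$-nilpotent multiplier of the pair is $$M^{(c)}(G,N)=\frac{R\cap[S,\,_cF]}{[R,\,_cF]}.$$ For $2\le i\le c+1$, $\gamma_{c+1}(T,F)_i=[D_1,D_2,\dots,D_{c+1}]$ with $D_1=D_i=T$ and $D_j=F$ for all $j\ne 1,i$. $\otimes^{c+1}(B,Q)=B\otimes Q\otimes\cdots\otimes Q$ with $c$ copies of $Q$, where the tensor product of groups is the tensor product over $\mathbf{Z}$ of their abelianizations. $d(X)$ is the minimal number of generators of the group $X$ and $\exp(X)$ is its exponent. *)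

(* Defs.v *)
(* Finite groups are [{group gT}]; the free group F of a presentation, which is
   infinite in general, is a [groupType], and its subgroups are sets of type
   [set F]. *)
From HB Require Import structures.
From mathcomp Require Import all_boot all_order all_algebra.
From mathcomp Require Import all_fingroup all_solvable.
From mathcomp Require Import ring_quotient generic_quotient freeg.
From mathcomp Require Import finmap boolp classical_sets cardinality.
From mathcomp Require Import constructive_ereal.

Set Implicit Arguments.
Unset Strict Implicit.
Unset Printing Implicit Defensive.

Local Open Scope classical_set_scope.
Local Open Scope group_scope.

Section Subgroups.
Variable F : groupType.
Implicit Types A B : set F.

Definition is_subgroup A := A 1 /\ forall x y, A x -> A y -> A (x * y^-1).

Definition generated A : set F := smallest is_subgroup A.

Definition commsub A B : set F :=
  generated [set [~ a, b] | a in A & b in B].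

(* [icommsub A B k] is [A, _k B]. *)
Definition icommsub A B k : set F := iter k (commsub^~ B) A.

Definition mulset A B : set F := [set a * b | a in A & b in B].

Lemma subgroupV A x : is_subgroup A -> A x -> A x^-1.
Proof. by move=> [A1 AF] Ax; rewrite -[x^-1]mul1g; apply: AF. Qed.

Lemma subgroupM A x y : is_subgroup A -> A x -> A y -> A (x * y).
Proof.
by move=> sA Ax Ay; rewrite -[y]invgK; apply: sA.2 => //; apply: subgroupV.
Qed.

Lemma generated_subgroup A : is_subgroup (generated A).
Proof.
split=> [B [[B1 _] _] //|x y Ax Ay B [sB AB]].
by apply: sB.2; [apply: Ax | apply: Ay].
Qed.

Lemma sub_generated A : A `<=` generated A.
Proof. by move=> x Ax B [_]; apply. Qed.

End Subgroups.

Record nsubgroup (F : groupType) := NSubgroup {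
  nsubgroup_set :> set F;
  nsubgroup_subgroup : is_subgroup nsubgroup_set;
  nsubgroup_conj : forall x y, nsubgroup_set x -> nsubgroup_set (x ^ y)
}.

Section NormalCommutator.
Variable F : groupType.
Implicit Types A : nsubgroup F.

Lemma commsubT_conj A x y :
  commsub A setT x -> commsub A setT (x ^ y).
Proof.
move=> Ax; pose B := [set z : F | commsub A setT (z ^ y)].
apply: (Ax B); split; first split.
- by rewrite /B /= conj1g; apply: (generated_subgroup _).1.
- move=> u v Bu Bv; rewrite /B /= conjMg conjVg.
  exact: (generated_subgroup _).2.
- move=> _ [a Aa [b _ <-]]; rewrite /B /= conjRg; apply: sub_generated.
  by exists (a ^ y); [apply: nsubgroup_conj | exists (b ^ y)].
Qed.

Definition commN A : nsubgroup F :=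
  NSubgroup (generated_subgroup _) (@commsubT_conj A).

(* [icommN A k] is [A, _k F]. *)
Definition icommN A k : nsubgroup F := iter k commN A.

Lemma icommNE A k : icommN A k = icommsub A setT k :> set F.
Proof. by elim: k => //= k ->. Qed.

Lemma full_subgroup : is_subgroup [set: F].
Proof. by []. Qed.

Definition fullN : nsubgroup F :=
  @NSubgroup F setT full_subgroup (fun _ _ _ => I).

End NormalCommutator.

(* [{multiplicative F -> H}] only asks for compatibility with products. *)
Section Kernel.
Variables (F H : groupType) (f : {multiplicative F -> H}).

Let f1 : f 1 = 1.
Proof. by apply: (mulgI (f 1)); rewrite -gmulfM !mulg1. Qed.

Let fV x : f x^-1 = (f x)^-1.
Proof. by apply: (mulgI (f x)); rewrite -gmulfM !mulgV f1. Qed.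

Lemma kernel_subgroup : is_subgroup [set x | f x = 1].
Proof. by split=> [|x y /= fx fy]; rewrite /= ?gmulfM ?fV ?fx ?fy ?invg1 ?mulg1. Qed.

Lemma kernel_conj x y : f x = 1 -> f (x ^ y) = 1.
Proof. by move=> fx; rewrite /conjg !gmulfM fx mul1g fV mulVg. Qed.

Definition kernel : nsubgroup F := NSubgroup kernel_subgroup kernel_conj.

End Kernel.

Section QuotientGroup.
Variables (F : groupType) (B : nsubgroup F).
Local Open Scope quotient_scope.

Definition quo_rel (x y : F) : bool := `[< nsubgroup_set B (x^-1 * y) >].

Lemma quo_rel_equiv : equiv_class_of quo_rel.
Proof.
have sB := nsubgroup_subgroup B.
split=> [x|x y|y x z]; rewrite /quo_rel.
- by apply/asboolP; rewrite mulVg; apply: sB.1.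
- by apply/asboolP/asboolP => /(subgroupV sB); rewrite invMg invgK.
- move=> /asboolP Bxy /asboolP Byz; apply/asboolP.
  by have := subgroupM sB Bxy Byz; rewrite mulgA mulgK.
Qed.

Canonical quo_equiv := EquivRelPack quo_rel_equiv.

Definition quo := {eq_quot quo_rel}.
HB.instance Definition _ := Choice.on quo.
HB.instance Definition _ := EqQuotient.on quo.

Definition quo_one : quo := \pi_quo 1.
Definition quo_mul (x y : quo) : quo := \pi_quo (repr x * repr y).
Definition quo_inv (x : quo) : quo := \pi_quo (repr x)^-1.

Lemma pi_quoP (x y : F) : reflect (nsubgroup_set B (x^-1 * y)) (\pi_quo x == \pi_quo y).
Proof. by rewrite eqmodE; apply: asboolP. Qed.

Lemma pi_quo_repr (x : F) : nsubgroup_set B ((repr (\pi_quo x))^-1 * x).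
Proof. by apply/pi_quoP; rewrite reprK. Qed.

Lemma pi_quoM (x y : F) : \pi_quo (x * y) = quo_mul (\pi_quo x) (\pi_quo y).
Proof.
apply/esym/eqP/pi_quoP; rewrite /=.
set x' := repr _; set y' := repr _.
have Bx : nsubgroup_set B (x'^-1 * x) by apply: pi_quo_repr.
have By : nsubgroup_set B (y'^-1 * y) by apply: pi_quo_repr.
have -> : (x' * y')^-1 * (x * y) = (x'^-1 * x) ^ y' * (y'^-1 * y).
  by rewrite /conjg invMg -!mulgA mulKVg.
apply: (subgroupM (nsubgroup_subgroup B)) By; exact: (nsubgroup_conj _ Bx).
Qed.

Lemma pi_quoV (x : F) : \pi_quo x^-1 = quo_inv (\pi_quo x).
Proof.
apply/esym/eqP/pi_quoP; rewrite invgK; set x' := repr _.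
have Bx : nsubgroup_set B (x'^-1 * x) by apply: pi_quo_repr.
have -> : x' * x^-1 = ((x'^-1 * x) ^ x'^-1)^-1.
  by rewrite /conjg !invMg !invgK -!mulgA mulgV mulg1.
apply: (subgroupV (nsubgroup_subgroup B)).
exact: (nsubgroup_conj _ Bx).
Qed.

Lemma quo_surj (x : quo) : exists a, x = \pi_quo a.
Proof. by exists (repr x); rewrite reprK. Qed.

Lemma quo_mulA : associative quo_mul.
Proof.
move=> x y z; have [a ->] := quo_surj x; have [b ->] := quo_surj y.
by have [d ->] := quo_surj z; rewrite -!pi_quoM mulgA.
Qed.

Lemma quo_mul1 : left_id quo_one quo_mul.
Proof. by move=> x; have [a ->] := quo_surj x; rewrite -pi_quoM mul1g. Qed.

Lemma quo_mulr1 : right_id quo_one quo_mul.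
Proof. by move=> x; have [a ->] := quo_surj x; rewrite -pi_quoM mulg1. Qed.

Lemma quo_mulV : left_inverse quo_one quo_inv quo_mul.
Proof.
by move=> x; have [a ->] := quo_surj x; rewrite -pi_quoV -pi_quoM mulVg.
Qed.

Lemma quo_mulrV : right_inverse quo_one quo_inv quo_mul.
Proof.
by move=> x; have [a ->] := quo_surj x; rewrite -pi_quoV -pi_quoM mulgV.
Qed.

HB.instance Definition _ :=
  isGroup.Build quo quo_mulA quo_mul1 quo_mulr1 quo_mulV quo_mulrV.

(* The subquotient A / B, for B <= A, as a subgroup of F / B. *)
Definition subquo (A : set F) : set quo := [set \pi_quo x | x in A].

End QuotientGroup.

Arguments subquo {F} B A _.

Section Invariants.
Variable H : groupType.
Implicit Types A : set H.

(* [ncard], [ngen] and [expo] stand for |A|, d(A) and exp(A).  Infinite values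
   are the top of the relevant order: 0 for divisibility, +oo for <=. *)
Definition ncard A : nat := #|` fset_set A|.

Definition generated_by A n :=
  `[< exists s : seq H, size s = n /\ generated [set` s] = A >].

Definition ngen A : \bar int :=
  if pselect (exists n, generated_by A n) is left ex
  then (ex_minn ex)%:Z%:E%E else +oo%E.

Definition kills A n := `[< (0 < n)%N /\ forall x, A x -> x ^+ n = 1 >].

Definition expo A : nat :=
  if pselect (exists n, kills A n) is left ex then ex_minn ex else 0%N.

End Invariants.

Section Tensor.
Local Open Scope ring_scope.

Section Abelianization.
Variable H : groupType.

Definition abelianization := quo (commN (fullN H)).
HB.instance Definition _ := Choice.on abelianization.
Local Notation mulab := (@quo_mul H (commN (fullN H))).

Lemma abelianization_mulC : commutative mulab.
Proof.
move=> x y; have [a ->] := quo_surj x; have [b ->] := quo_surj y.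
rewrite -!pi_quoM; apply/eqP/pi_quoP; apply: sub_generated => /=.
by exists b => //; exists a => //; rewrite commgEl /conjg invMg !mulgA.
Qed.

HB.instance Definition _ := GRing.isZmodule.Build abelianization
  (@quo_mulA _ _) abelianization_mulC (@quo_mul1 _ _) (@quo_mulV _ _).
End Abelianization.

(* The free abelian group on A * B modulo the bilinearity relations. *)
Section TensorZ.
Variables A B : zmodType.
Local Notation Z_AB := {freeg (A * B)%type / int}.

Definition symbol (a : A) (b : B) : Z_AB := [freeg [:: (1, (a, b))]].

Inductive bilinear_relation : Z_AB -> Prop :=
| BilinearL a a' b :
    bilinear_relation (symbol (a + a') b - symbol a b - symbol a' b)
| BilinearR a b b' :
    bilinear_relation (symbol a (b + b') - symbol a b - symbol a b').

Definition bilinear_relations : {pred Z_AB} := fun x =>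
  `[< forall S : {pred Z_AB}, zmod_closed S ->
      (forall r, bilinear_relation r -> r \in S) -> x \in S >].

Lemma bilinear_relations_zmod_closed : zmod_closed bilinear_relations.
Proof.
split=> [|x y /asboolP Rx /asboolP Ry]; apply/asboolP=> S cS sS.
  exact: cS.1.
by apply: cS.2; [apply: Rx | apply: Ry].
Qed.

HB.instance Definition _ := GRing.isZmodClosed.Build Z_AB bilinear_relations
  bilinear_relations_zmod_closed.

Definition tensor : zmodType := Quotient.quot bilinear_relations.
End TensorZ.

(* B (x) Q (x) ... (x) Q with c copies of Q, written multiplicatively. *)
Definition tensor_power (c : nat) (B Q : groupType) : groupType :=
  Algebra.to_multiplicative
    (iter c (fun X : zmodType => tensor X (abelianization Q))
       (abelianization B : zmodType)).

End Tensor.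

(* F is free with basis X: the universal property among all groups. *)
Definition free_on (F : groupType) (X : set F) :=
  forall (H : groupType) (f : F -> H),
  exists phi : {multiplicative F -> H},
    (forall x, X x -> phi x = f x) /\
    (forall psi : {multiplicative F -> H},
       (forall x, X x -> psi x = f x) -> psi =1 phi).

Definition is_free (F : groupType) := exists X : set F, free_on X.

(* 1 -> R -> F -> G -> 1 *)
Record free_presentation (gT : finGroupType) (G : {group gT}) :=
  FreePresentation {
  pres_group :> groupType;
  pres_map : {multiplicative pres_group -> gT};
  pres_free : is_free pres_group;
  pres_range : range pres_map = [set` G]
}.

Section Multiplier.
Variables (gT : finGroupType) (G : {group gT}) (P : free_presentation G).

Definition relators : nsubgroup P := kernel (pres_map P).

(* (R `&` [S, _c F]) / [R, _c F], S being the preimage of N. *)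
Definition multiplier (c : nat) (N : {group gT}) :
    set (quo (icommN relators c)) :=
  subquo (icommN relators c)
    (relators `&` icommsub (pres_map P @^-1` [set` N]) setT c).

End Multiplier.

Arguments multiplier {gT G} P c N _.

(* gamma_{c+1}(T, F)_i = [D_1, ..., D_{c+1}], left-normed. *)
Definition gammai (F : groupType) (c : nat) (T : set F) (i : nat) : set F :=
  foldl (@commsub F) T [seq (if j == i then T else setT) | j <- iota 2 c].

(* [R, _c F] \prod_(i = 2 .. c + 1) gamma_{c+1}(T, F)_i  modulo  [R, _c F]. *)
Definition gamma_quo (F : groupType) (c : nat) (R : nsubgroup F) (T : set F) :
    set (quo (icommN R c)) :=
  subquo (icommN R c)
    (mulset (icommsub R setT c)
       (\big[@mulset F/[set 1]]_(2 <= i < c.+2) gammai c T i)).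

Arguments gamma_quo {F} c R T _.

(* [N, _c G] in a finite group. *)
Definition fcomm (gT : finGroupType) (N G : {set gT}) (c : nat) : {set gT} :=
  iter c (fun X : {set gT} => [~: X, G]) N.

(* Main.v *)
(* Write R, S, T for the preimages of 1, N, K in F, and A_c for [A, _c F].  As K
   is central, T_c <= R for c >= 1, whence two extensions:
     1 -> T_c / R_c -> M(G, N) -> I -> 1,
     1 -> I -> (T /\ S_c) / T_c -> K /\ [N, _c G] -> 1,
   and (T /\ S_c) / T_c is M(G / K, N / K), since free liftings between two
   presentations are mutually inverse on S_c modulo T_c.  Put E_0 = R and
   E_(k+1) = [E_k, F] [T_k, T]; then T_(k+1) <= E_k <= T_k, so (u, f) |-> [u, f]
   induces a bilinear map T_k / E_k x (G / K)^ab -> T_(k+1) / E_(k+1), and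
   T_c / E_c is a quotient of the tensor power of K and G / K.  Finally
   E_c = R_c \prod_i gamma_(c+1)(T, F)_i.  Order, number of generators and
   exponent behave well in extensions. *)
From HB Require Import structures.
Require Import Defs.
From mathcomp Require Import all_boot all_order all_algebra.
From mathcomp Require Import all_fingroup all_solvable.
From mathcomp Require Import ring_quotient generic_quotient freeg finmap.
From mathcomp Require Import boolp classical_sets functions cardinality.
From mathcomp Require Import constructive_ereal.
(* [generated] and other names also exist in fingroup: those of Defs prevail. *)
Import Defs Order.TTheory GRing.Theory.

Set Implicit Arguments.
Unset Strict Implicit.
Unset Printing Implicit Defensive.

Local Open Scope classical_set_scope.
Local Open Scope group_scope.

(** * Order, number of generators and exponent *)

(** The values given to infinite sets (0 for divisibility, [+oo] for [<=]) make the extension rules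
    below unconditional, so (i), (ii) and (iii) follow the same chain of extensions. The chain bends
    at I, which is a subgroup of M(G / K, N / K) and not a quotient of it. For orders this is what
    produces the factor |K /\ [N, _c G]|. For exponents it is harmless. For d it is an obstacle,
    since d is not monotone on subgroups: an abelian ambient group is needed, and with it the bound
    for subgroups of finitely generated abelian groups. One inclusion is used three times,
    [T_k, gamma_(n+1)(F)] <= T_(k+n+1): it makes M(G / K, N / K) abelian, it shows that a change of
    lifting does not matter on S_c modulo T_c, and it makes commutators with [F, F] vanish in the
    tensor tower. The E_k answer a failure of the naive choice R_k: [u, f] modulo R_(k+1) would
    depend on f modulo T, because [T_k, T] need not lie in R_(k+1). Adding [T_k, T] at each step is
    the least repair, and it accounts for the last factor of the three bounds, E_c / R_c. *)

Lemma card_fset_set_inj (T U : choiceType) (f : T -> U) (A : set T) :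
  {in A &, injective f} -> #|` fset_set (f @` A)| = #|` fset_set A|.
Proof.
move=> fI; case: (pselect (finite_set A)) => [finA|infA].
  rewrite fset_set_image // card_in_imfset //= => x y.
  by rewrite !in_fset_set //; apply: fI.
have infB : ~ finite_set (f @` A).
  by rewrite (eq_finite_set (inj_card_eq fI)).
by rewrite /fset_set; case: pselect => // _; case: pselect.
Qed.

Lemma cardfsM (T U : choiceType) (A : {fset T}) (B : {fset U}) :
  #|` (A `*` B)%fset| = (#|` A| * #|` B|)%N.
Proof.
rewrite /= -(size_allpairs pair); apply/perm_size/uniq_perm; first exact: fset_uniq.
  by apply: allpairs_uniq; rewrite ?fset_uniq // => -[x y] [x' y'].
move=> [x y]; rewrite in_fsetM /=; apply/andP/allpairsP => [[Ax By]|].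
  by exists (x, y).
by move=> [[x' y'] /= [Ax By [-> ->]]].
Qed.

(* The library states these for unital morphisms; between groups preserving
   products is enough. *)
Section GroupMorphism.
Variables (G H : groupType) (f : {multiplicative G -> H}).

Lemma gmorph1 : f 1 = 1.
Proof. by apply: (mulgI (f 1)); rewrite -gmulfM !mulg1. Qed.

Lemma gmorphV x : f x^-1 = (f x)^-1.
Proof. by apply: (mulgI (f x)); rewrite -gmulfM !mulgV gmorph1. Qed.

Lemma gmorphF x y : f (x * y^-1) = f x * (f y)^-1.
Proof. by rewrite gmulfM gmorphV. Qed.

Lemma gmorphR x y : f [~ x, y] = [~ f x, f y].
Proof. by rewrite /commg /conjg !gmulfM !gmorphV. Qed.

Lemma gmorphJ x y : f (x ^ y) = f x ^ f y.
Proof. by rewrite /conjg !gmulfM gmorphV. Qed.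

Lemma gmorphX x n : f (x ^+ n) = f x ^+ n.
Proof.
by elim: n => [|n IH]; rewrite ?expg0 ?gmorph1 // !expgS gmulfM IH.
Qed.

End GroupMorphism.

Section SubgroupSets.
Variable F : groupType.
Implicit Types A B : set F.

Lemma subgroup1 A : is_subgroup A -> A 1. Proof. by case. Qed.

Lemma subgroupX A x n : is_subgroup A -> A x -> A (x ^+ n).
Proof.
move=> sA Ax; elim: n => [|n IH]; first by rewrite expg0; apply: subgroup1.
by rewrite expgS; apply: subgroupM.
Qed.

Lemma subgroupMr A x y : is_subgroup A -> A y -> A (x * y) -> A x.
Proof. by move=> sA Ay /(sA.2 _ _) /(_ Ay); rewrite mulgK. Qed.

Lemma subgroupI A B : is_subgroup A -> is_subgroup B -> is_subgroup (A `&` B).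
Proof.
move=> [A1 AF] [B1 BF]; split=> // x y [Ax Bx] [Ay By].
by split; [apply: AF | apply: BF].
Qed.

Lemma generated_sub A B : is_subgroup B -> A `<=` B -> generated A `<=` B.
Proof. by move=> sB AB x; apply. Qed.

Lemma subgroup_trivial : is_subgroup [set 1 : F].
Proof. by split=> // x y -> ->; rewrite /= mulgV. Qed.

Lemma generated0 : generated (set0 : set F) = [set 1].
Proof.
apply/seteqP; split; first exact: generated_sub subgroup_trivial _.
by move=> x ->; apply: (generated_subgroup _).1.
Qed.

End SubgroupSets.

Section Image.
Variables (F H : groupType) (f : {multiplicative F -> H}).
Implicit Types A B : set F.

Lemma subgroup_image A : is_subgroup A -> is_subgroup (f @` A).
Proof.
move=> [A1 AF]; split; first by exists 1 => //; rewrite gmorph1.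
by move=> _ _ [x Ax <-] [y Ay <-]; exists (x * y^-1); [apply: AF | rewrite gmorphF].
Qed.

Lemma subgroup_preimage (B : set H) : is_subgroup B -> is_subgroup (f @^-1` B).
Proof.
move=> [B1 BF]; split; first by rewrite /preimage /= gmorph1.
by move=> x y Bx By; rewrite /preimage /= gmorphF; apply: BF.
Qed.

Lemma generated_image A : f @` generated A = generated (f @` A).
Proof.
apply/seteqP; split.
  apply/image_subP; apply: generated_sub.
    exact/subgroup_preimage/generated_subgroup.
  by move=> x Ax; apply: sub_generated; exists x.
apply: generated_sub; first exact/subgroup_image/generated_subgroup.
by apply: image_subset; apply: sub_generated.
Qed.

Lemma commsub_image A B : f @` commsub A B = commsub (f @` A) (f @` B).
Proof.
rewrite /commsub generated_image; congr generated; apply/seteqP; split.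
  move=> _ [_ [a Aa [b Bb <-]] <-]; exists (f a); first by exists a.
  by exists (f b); [exists b | rewrite -gmorphR].
move=> _ [_ [a Aa <-] [_ [b Bb <-] <-]]; exists [~ a, b]; last by rewrite gmorphR.
by exists a => //; exists b.
Qed.

End Image.

Section Invariants.
Variable H : groupType.
Implicit Types A B : set H.

Lemma ngenP A : 
  (exists2 n, generated_by A n & ngen A = n%:Z%:E%E) \/
  (~ (exists n, generated_by A n) /\ ngen A = +oo%E).
Proof.
rewrite /ngen; case: pselect => [ex|nex]; last by right.
by left; case: ex_minnP => n An _; exists n.
Qed.

Lemma ngen_le A n : generated_by A n -> (ngen A <= n%:Z%:E)%E.
Proof.
move=> An; rewrite /ngen; case: pselect => [ex|[]]; last by exists n.
by case: ex_minnP => m _ /(_ n An) mn; rewrite lee_fin lez_nat.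
Qed.

(** [generated_by] asks for a list of length exactly [n], so a shorter list is padded with copies of
    [1]. *)
Lemma generated_by_leq A (s : seq H) n :
  (size s <= n)%N -> generated [set` s] = A -> generated_by A n.
Proof.
move=> sn sA; apply/asboolP; exists (s ++ nseq (n - size s) 1).
split; first by rewrite size_cat size_nseq subnKC.
rewrite -sA; apply/seteqP; split; apply: generated_sub; try exact: generated_subgroup.
  move=> x /=; rewrite mem_cat mem_nseq => /orP[xs|/andP[_ /eqP->]].
    exact: sub_generated.
  exact: (generated_subgroup _).1.
by move=> x xs; apply: sub_generated; rewrite /= mem_cat xs.
Qed.

Lemma ngen_trivial : ngen [set 1 : H] = 0%E.
Proof.
apply/eqP; rewrite eq_le; apply/andP; split.
  apply: (@ngen_le _ 0); apply: (@generated_by_leq _ [::]) => //.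
  rewrite -generated0; congr generated; apply/seteqP; split=> x //=.
by case: (ngenP [set 1 : H]) => [[n _ ->]|[_ ->]]; rewrite ?leey // lee_fin.
Qed.

Lemma expo_exp A x : A x -> x ^+ expo A = 1.
Proof.
move=> Ax; rewrite /expo; case: pselect => [ex|_]; last by rewrite expg0.
by case: ex_minnP => n /asboolP[_ /(_ x Ax)].
Qed.

(** For [n = 0] everything divides. Otherwise the remainder of [n] by the least killing exponent
    also kills [A], so minimality forces it to be 0. *)
Lemma expo_dvd A n : (forall x, A x -> x ^+ n = 1) -> (expo A %| n)%N.
Proof.
move=> An; case: n An => [|n] An; first by rewrite dvdn0.
rewrite /expo; case: pselect => [ex|[]]; last by exists n.+1; apply/asboolP.
case: ex_minnP => m /asboolP[m0 Am] min; rewrite /dvdn.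
have := ltn_pmod n.+1 m0; case: posnP => [->//|r0]; rewrite ltnNge min //.
apply/asboolP; split=> // x Ax; have := An x Ax.
by rewrite {1}(divn_eq n.+1 m) expgnDr mulnC expgnA Am // expg1n mul1g.
Qed.

Lemma expo_subset A B : A `<=` B -> (expo A %| expo B)%N.
Proof. by move=> AB; apply: expo_dvd => x /AB; apply: expo_exp. Qed.

Lemma expo_trivial : expo [set 1 : H] = 1%N.
Proof. by apply/eqP; rewrite -dvdn1; apply: expo_dvd => x ->. Qed.

Lemma ncard_trivial : ncard [set 1 : H] = 1%N.
Proof. by rewrite /ncard fset_set1 cardfs1. Qed.

End Invariants.

Section Extension.
Variables (H H' : groupType) (f : {multiplicative H -> H'}).
Variables (A : set H) (sA : is_subgroup A).

(** With [s] a set-theoretic section of [f], the map (y, k) to [s y * k] is a bijection from the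
    product of image and kernel onto [A]. If a factor is infinite both sides are 0: the other factor
    contains 1, so the product set is infinite too. *)
Lemma ncard_image_kernel : ncard A = (ncard (f @` A) * ncard (A `&` kernel f))%N.
Proof.
have [s sP] : {s : H' -> H & forall y, (f @` A) y -> A (s y) /\ f (s y) = y}.
  apply: (@choice _ _ (fun y x => (f @` A) y -> A x /\ f x = y)) => y.
  case: (pselect ((f @` A) y)) => [[x Ax fx]|]; last by exists 1.
  by exists x.
pose I := f @` A; pose L := A `&` kernel f.
pose g (u : H' * H) := s u.1 * u.2.
have gI : {in I `*` L &, injective g}.
  move=> [y k] [y' k']; rewrite !inE /= => -[Iy [Ak fk]] [Iy' [Ak' fk']].
  rewrite /g /= => e; have := congr1 f e.
  rewrite !gmulfM fk fk' !mulg1 (sP _ Iy).2 (sP _ Iy').2 => e'.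
  by subst y'; move/mulgI: e => ->.
have gA : g @` (I `*` L) = A.
  apply/seteqP; split=> [_ [[y k] /= [Iy [Ak _]] <-]|x Ax].
    by apply: subgroupM => //; apply: (sP _ Iy).1.
  have Ifx : I (f x) by exists x.
  have [As fs] := sP _ Ifx.
  exists (f x, (s (f x))^-1 * x); last by rewrite /g /= mulKVg.
  split=> //=; split; first by apply: subgroupM => //; apply: subgroupV.
  by rewrite /= gmulfM gmorphV fs mulVg.
rewrite /ncard -[in LHS]gA card_fset_set_inj //.
case: (pselect (finite_set I /\ finite_set L)) => [[finI finL]|nf].
  by rewrite fset_setX // cardfsM.
have I1 : I 1 by exists 1; [apply: sA.1 | rewrite gmorph1].
have L1 : L 1 by split; [apply: sA.1 | rewrite /= gmorph1].
have infIL : ~ finite_set (I `*` L).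
  move=> fin; apply: nf; split.
    rewrite (_ : I = fst @` (I `*` L)); first exact: finite_image.
    by apply/seteqP; split=> [y Iy|_ [[y k] [Iy _] <-]//]; exists (y, 1).
  rewrite (_ : L = snd @` (I `*` L)); first exact: finite_image.
  by apply/seteqP; split=> [y Iy|_ [[y k] [_ Iy] <-]//]; exists (1, y).
have fset0E (T : choiceType) (B : set T) : ~ finite_set B -> #|` fset_set B| = 0%N.
  by move=> infB; rewrite /fset_set; case: pselect => // _; rewrite cardfs0.
rewrite fset0E //; case: (pselect (finite_set I)) => [finI|infI].
  by rewrite [X in (_ * X)%N]fset0E ?muln0 // => finL; apply: nf.
by rewrite [X in (X * _)%N]fset0E ?mul0n.
Qed.

Lemma ncard_image_dvd : (ncard (f @` A) %| ncard A)%N.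
Proof. by rewrite ncard_image_kernel dvdn_mulr. Qed.

Lemma ngen_image_kernel : (ngen A <= ngen (f @` A) + ngen (A `&` kernel f))%E.
Proof.
case: (ngenP (f @` A)) => [[n /asboolP[t [tn tA]] ->]|[_ ->]]; last first.
  rewrite addye ?leey //.
  by case: (ngenP (A `&` kernel f)) => [[m _ ->]|[_ ->]].
case: (ngenP (A `&` kernel f)) => [[m /asboolP[r [rm rA]] ->]|[_ ->]]; last first.
  by rewrite addey ?leey.
have [s sP] : {s : H' -> H & forall y, (f @` A) y -> A (s y) /\ f (s y) = y}.
  apply: (@choice _ _ (fun y x => (f @` A) y -> A x /\ f x = y)) => y.
  case: (pselect ((f @` A) y)) => [[x Ax fx]|]; last by exists 1.
  by exists x.
rewrite -EFinD -PoszD; apply: ngen_le; apply/asboolP; exists (map s t ++ r).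
have tI y : y \in t -> (f @` A) y by move=> yt; rewrite -tA; apply: sub_generated.
split; first by rewrite size_cat size_map tn rm.
apply/seteqP; split.
  apply: generated_sub => // x /=; rewrite mem_cat => /orP[/mapP[y yt ->]|xr].
    exact: (sP _ (tI _ yt)).1.
  by have [] : (A `&` kernel f) x by rewrite -rA; apply: sub_generated.
set s0 := [set` _]; set B := generated s0.
have sB : is_subgroup B by apply: generated_subgroup.
have s0B x : s0 x -> B x by exact: sub_generated.
have rB : A `&` kernel f `<=` B.
  rewrite -rA; apply: generated_sub => // x xr; apply: s0B; rewrite /s0 /=.
  by rewrite (mem_cat x (map s t) r) xr orbT.
(* Every value of [f] on [A] is already taken on [B]. Intersecting with [A] keeps the quotient of
   [x] by such a preimage inside [A], hence in the kernel part. *)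
have tB : f @` A `<=` f @` (B `&` A).
  rewrite -[X in X `<=` _]tA; apply: generated_sub.
    by apply: subgroup_image; apply: subgroupI.
  move=> y yt; have [As fs] := sP _ (tI _ yt); exists (s y) => //; split=> //.
  by apply: s0B; rewrite /s0 /= (mem_cat (s y) (map s t) r) map_f.
move=> x Ax; have [b [Bb Ab] fb] := tB (f x) (ex_intro2 _ _ x Ax erefl).
rewrite -(mulKVg b x); apply: (subgroupM sB) => //; apply: (rB (b^-1 * x)); split.
  by apply: subgroupM => //; apply: subgroupV.
by rewrite /= gmulfM gmorphV fb mulVg.
Qed.

Lemma ngen_image_le : (ngen (f @` A) <= ngen A)%E.
Proof.
case: (ngenP A) => [[n /asboolP[t [tn tA]] ->]|[_ ->]]; last by rewrite leey.
apply: ngen_le; apply/asboolP; exists (map f t); split; first by rewrite size_map.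
rewrite -tA generated_image; congr generated; apply/seteqP; split=> y /=.
  by move=> /mapP[x xt ->]; exists x.
by move=> [x xt <-]; apply: map_f.
Qed.

Lemma expo_image_kernel : (expo A %| expo (f @` A) * expo (A `&` kernel f))%N.
Proof.
apply: expo_dvd => x Ax; rewrite expgnA; apply: expo_exp; split.
  exact: subgroupX.
by rewrite /= gmorphX; apply: expo_exp; exists x.
Qed.

Lemma expo_image_dvd : (expo (f @` A) %| expo A)%N.
Proof. by apply: expo_dvd => _ [x Ax <-]; rewrite -gmorphX expo_exp // gmorph1. Qed.

End Extension.

(** * Generators of subgroups of abelian groups *)

Definition abelian_set (H : groupType) (A : set H) :=
  forall x y, A x -> A y -> commute x y.

Lemma subgroup_commuting (H : groupType) (x : H) : is_subgroup [set y | commute x y].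
Proof.
split; first exact: commute1.
by move=> y z xy xz; apply: commuteM => //; apply: commuteV.
Qed.

Lemma abelian_set_generated (H : groupType) (A : set H) :
  abelian_set A -> abelian_set (generated A).
Proof.
move=> cA x y Ax Ay.
suff : generated A `<=` [set x | commute x y] by apply.
have sC z : is_subgroup [set x | commute x z].
  have := subgroup_commuting z; congr is_subgroup.
  by apply/seteqP; split=> u /= /commute_sym.
apply: generated_sub => // u Au /=.
suff : generated A `<=` [set y | commute u y] by apply.
by apply: generated_sub; [apply: subgroup_commuting | move=> v Av; apply: cA].
Qed.

(* Euclidean division on the exponent of the first generator, as for subgroups
   of Z^n. *)
Lemma abelian_subgroup_generators (H : groupType) (s : seq H) (B : set H) :
  abelian_set (generated [set` s]) -> is_subgroup B ->
  B `<=` generated [set` s] ->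
  exists2 t : seq H, (size t <= size s)%N & generated [set` t] = B.
Proof.
elim: s B => [|a s IH] B cA sB BA.
  exists [::] => //; have e : [set` [::]] = set0 :> set H by apply/seteqP; split.
  rewrite e generated0 in BA *; apply/seteqP; split=> // _ ->.
  exact: subgroup1.
pose A := generated [set` a :: s]; pose A' := generated [set` s].
have sA : is_subgroup A by apply: generated_subgroup.
have sA' : is_subgroup A' by apply: generated_subgroup.
have Aa : A a by apply: sub_generated => /=; rewrite mem_head.
have A'A x : A' x -> A x.
  move: x; apply: generated_sub => // x xs; apply: sub_generated.
  by rewrite /= inE; apply/orP; right.
have cA' : abelian_set A' by move=> x y A'x A'y; apply: cA; apply: A'A.
have cX x n : A x -> commute (a ^+ n) x.
  by move=> Ax; apply: commute_sym; apply: commuteX; apply: cA.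
(* Exponents are natural numbers, so a possibly negative power of [a] is recorded by one power on
   each side. *)
have decomp z : A z -> exists m n w, A' w /\ z * a ^+ m = a ^+ n * w.
  apply: (@generated_sub _ _ [set x | exists m n w, A' w /\ x * a ^+ m = a ^+ n * w]).
    split; first by exists 0, 0, 1; split; [apply: subgroup1 | rewrite !mulg1].
    move=> u v [m [n [w [A'w uE]]]] [m' [n' [w' [A'w' vE]]]].
    exists (m + n')%N, (n + m')%N, (w * w'^-1); split; first exact: sA'.2.
    have vE' : v^-1 * a ^+ n' = a ^+ m' * w'^-1.
      by apply: (mulgI v); rewrite mulKVg mulgA vE mulgK.
    have Au : A u.
      apply: (subgroupMr sA (subgroupX m sA Aa)); rewrite uE.
      exact: (subgroupM sA (subgroupX n sA Aa) (A'A _ A'w)).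
    have Av : A v.
      apply: (subgroupMr sA (subgroupX m' sA Aa)); rewrite vE.
      exact: (subgroupM sA (subgroupX n' sA Aa) (A'A _ A'w')).
    rewrite !expgnDr -!mulgA (mulgA v^-1) -(cX v^-1 m); last exact: (subgroupV sA Av).
    rewrite -(mulgA (a ^+ m)) vE' (mulgA u) uE -!mulgA; congr (_ * _).
    by rewrite !mulgA (cX w m') //; apply: A'A.
  move=> x /=; rewrite inE => /orP[/eqP->|xs].
    by exists 0, 1%N, 1; split; [apply: subgroup1 | rewrite !mulg1].
  by exists 0, 0, x; split; [apply: sub_generated | rewrite mulg1 mul1g].
(* The positive exponents of [a] met in [B] modulo [A']. The least one, [d], plays the part of the
   generator of an ideal of Z. *)
pose D n := `[< (0 < n)%N /\ exists b w, [/\ B b, A' w & b = a ^+ n * w] >].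
have normal_form b : B b -> exists n w, A' w /\ (b = a ^+ n * w \/ b^-1 = a ^+ n * w).
  move=> Bb; have Ab := BA _ Bb; have [m [n [w [A'w bE]]]] := decomp b Ab.
  have bE' : b = a ^+ n * w * (a ^+ m)^-1 by rewrite -bE mulgK.
  case: (leqP m n) => mn.
    exists (n - m)%N, w; split=> //; left; rewrite bE'.
    rewrite -{1}(subnK mn) expgnDr -!mulgA; congr (_ * _).
    by rewrite mulgA (cX w m) ?mulgK //; apply: A'A.
  exists (m - n)%N, w^-1; split; first exact: (subgroupV sA' A'w).
  right; rewrite bE' !invMg invgK -{1}(subnK (ltnW mn)) expgnDr -!mulgA; congr (_ * _).
  rewrite (cX (w^-1 * _)) //; last first.
    exact: (subgroupM sA (subgroupV sA (A'A _ A'w)) (subgroupV sA (subgroupX n sA Aa))).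
  by rewrite mulgVK.
(* If no positive exponent occurs, [B] lies in [A'] and induction applies directly. Otherwise [B] is
   generated by [b0], which has exponent [d], and by the generators of its intersection with
   [A']. *)
case: (pselect (exists n, D n)) => [ex|noD]; last first.
  have BA' : B `<=` A'.
    move=> b Bb; have [n [w [A'w bE]]] := normal_form b Bb.
    have n0 : n = 0.
      apply/eqP; rewrite -leqn0 leqNgt; apply/negP => n0; apply: noD; exists n.
      apply/asboolP; split=> //; case: bE => bE; first by exists b, w.
      by exists b^-1, w; split=> //; apply: (subgroupV sB Bb).
    by move: bE; rewrite n0 expg0 mul1g => -[->|/(canRL invgK) ->] //; apply: (subgroupV sA').
  by have [t ts tB] := IH B cA' sB BA'; exists t => //; apply: leqW.
case: (ex_minnP ex) => d /asboolP[d0 [b0 [w0 [Bb0 A'w0 b0E]]]] dmin.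
have [|t ts tB] := IH (B `&` A') cA' (subgroupI sB sA'); first by move=> x [].
exists (b0 :: t) => //; apply/seteqP; split.
  apply: generated_sub => // x /=; rewrite inE => /orP[/eqP-> //|xt].
  by have [] : (B `&` A') x by rewrite -tB; apply: sub_generated.
set C := generated _; have sC : is_subgroup C by apply: generated_subgroup.
have Cb0 : C b0 by apply: sub_generated => /=; rewrite mem_head.
have tC : B `&` A' `<=` C.
  rewrite -tB; apply: generated_sub => // x xt; apply: sub_generated.
  by rewrite /= inE; apply/orP; right.
have pos b n w : B b -> A' w -> b = a ^+ n * w -> C b.
  move=> Bb A'w bE; pose q := (n %/ d)%N; pose r := (n %% d)%N.
  have Ab0 : A b0 by apply: BA.
  have b0q : b0 ^+ q = a ^+ (q * d) * w0 ^+ q.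
    rewrite b0E expgMn; first by rewrite -expgnA mulnC.
    by apply: cX; apply: A'A.
  have e : (b0 ^+ q)^-1 * b = a ^+ r * ((w0 ^+ q)^-1 * w).
    apply: (mulgI (b0 ^+ q)); rewrite mulKVg bE {1}(divn_eq n d) expgnDr b0q -!mulgA.
    congr (_ * _); rewrite [RHS]mulgA -(cX (w0 ^+ q)) -?mulgA ?mulKVg //.
    exact: (A'A _ (subgroupX q sA' A'w0)).
  have A'w' : A' ((w0 ^+ q)^-1 * w).
    exact: (subgroupM sA' (subgroupV sA' (subgroupX q sA' A'w0)) A'w).
  have B' : B ((b0 ^+ q)^-1 * b).
    exact: (subgroupM sB (subgroupV sB (subgroupX q sB Bb0)) Bb).
  (* Dividing [b] by the power [q] of [b0] leaves an element of [B] with exponent [r < d], so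
     [r > 0] would contradict the choice of [d]. *)
  have r0 : r = 0.
    apply/eqP; rewrite -leqn0 leqNgt; apply/negP => r0.
    have : D r by apply/asboolP; split=> //; exists ((b0 ^+ q)^-1 * b), ((w0 ^+ q)^-1 * w).
    by move/dmin; rewrite leqNgt ltn_pmod.
  rewrite -(mulKVg (b0 ^+ q) b); apply: (subgroupM sC (subgroupX q sC Cb0)).
  by apply: (tC (_ * _)); split=> //; rewrite e r0 expg0 mul1g.
move=> b Bb; have [n [w [A'w [bE|bE]]]] := normal_form b Bb; first exact: pos bE.
rewrite -(invgK b); apply: (subgroupV sC); apply: pos bE => //.
exact: subgroupV.
Qed.

Lemma ngen_abelian_subset (H : groupType) (A B : set H) :
  abelian_set A -> is_subgroup B -> B `<=` A -> (ngen B <= ngen A)%E.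
Proof.
move=> cA sB BA; case: (ngenP A) => [[n /asboolP[s [sn sA]] ->]|[_ ->]]; last by rewrite leey.
rewrite -sA in cA BA; have [t ts tB] := abelian_subgroup_generators cA sB BA.
by apply: ngen_le; apply: generated_by_leq tB; rewrite -sn.
Qed.

(** * Normal subgroups and quotients *)

Reserved Notation "x \isin A" (at level 70, no associativity).
Notation "x \isin A" := (nsubgroup_set A x) : group_scope.

Lemma commN_eq1 (G : groupType) (x y : G) : [~ x, y] = 1 <-> commute x y.
Proof. by split=> [/eqP/commgP|/commgP/eqP]. Qed.

Section NormalSubgroups.
Variable F : groupType.
Implicit Types A B C Z : nsubgroup F.

(** Proof irrelevance makes equality of records follow from equality of sets, so that the laws of
    [joinN] are genuine equations. *)
Lemma nsubgroup_eq A B : A = B :> set F -> A = B.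
Proof.
by case: A B => A sA nA [B sB nB] /= AB; subst B; congr NSubgroup; apply: Prop_irrelevance.
Qed.

Lemma nsubgroup1 A : 1 \isin A. Proof. exact: (nsubgroup_subgroup A).1. Qed.

Lemma nsubgroupM A x y : x \isin A -> y \isin A -> (x * y) \isin A.
Proof. exact: (subgroupM (nsubgroup_subgroup A)). Qed.

Lemma nsubgroupV A x : x \isin A -> x^-1 \isin A.
Proof. exact: (subgroupV (nsubgroup_subgroup A)). Qed.

Lemma nsubgroupRl A x y : x \isin A -> [~ x, y] \isin A.
Proof.
by move=> Ax; apply: nsubgroupM; [apply: nsubgroupV | apply: nsubgroup_conj].
Qed.

Lemma commsub_conj A B x y : commsub A B x -> commsub A B (x ^ y).
Proof.
move: x; apply: generated_sub; first split.
- by rewrite /= conj1g; apply: (generated_subgroup _).1.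
- by move=> u v Bu Bv; rewrite /= conjMg conjVg; apply: (generated_subgroup _).2.
- move=> _ [a Aa [b Bb <-]]; rewrite /= conjRg; apply: sub_generated.
  by exists (a ^ y); [apply: nsubgroup_conj | exists (b ^ y) => //; apply: nsubgroup_conj].
Qed.

Definition commNN A B : nsubgroup F :=
  NSubgroup (generated_subgroup _) (@commsub_conj A B).

Lemma commNN_full A : commN A = commNN A (fullN F).
Proof. exact: nsubgroup_eq. Qed.

Lemma mem_commNN A B x y : x \isin A -> y \isin B -> [~ x, y] \isin commNN A B.
Proof. by move=> Ax By; apply: sub_generated; exists x => //; exists y. Qed.

Lemma mem_commN A x y : x \isin A -> [~ x, y] \isin commN A.
Proof. by move=> Ax; apply: sub_generated; exists x => //; exists y. Qed.

Lemma commNN_sub A B (C : set F) : is_subgroup C ->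
  (forall x y, x \isin A -> y \isin B -> C [~ x, y]) -> commNN A B `<=` C.
Proof.
by move=> sC ABC; apply: generated_sub => // _ [x Ax [y By <-]]; apply: ABC.
Qed.

Lemma commN_sub A (C : set F) : is_subgroup C ->
  (forall x y, x \isin A -> C [~ x, y]) -> commN A `<=` C.
Proof. by rewrite commNN_full => sC subAC; apply: commNN_sub => // x y /subAC. Qed.

Lemma commN_subset A : commN A `<=` A.
Proof.
by apply: commN_sub => [|x y]; [apply: nsubgroup_subgroup | apply: nsubgroupRl].
Qed.

Lemma commNS A B : A `<=` B -> commN A `<=` commN B.
Proof.
move=> AB; apply: commN_sub => [|x y /AB]; last exact: mem_commN.
exact: nsubgroup_subgroup.
Qed.

Lemma icommNS A B k : A `<=` B -> icommN A k `<=` icommN B k.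
Proof. by move=> AB; elim: k => //= k; apply: commNS. Qed.

Lemma icommN_decr A k : icommN A k.+1 `<=` icommN A k.
Proof. exact: commN_subset. Qed.

Lemma icommN_subset A k : icommN A k `<=` A.
Proof. by elim: k => //= k IH x /commN_subset /IH. Qed.

Lemma icommNSr A k : icommN A k.+1 = icommN (commN A) k.
Proof. by rewrite /icommN iterSr. Qed.

Lemma mulset_subgroup A B : is_subgroup (mulset A B).
Proof.
split; first by exists 1; [apply: nsubgroup1 | exists 1; rewrite ?mulg1 //; apply: nsubgroup1].
move=> _ _ [a Aa [b Bb <-]] [a' Aa' [b' Bb' <-]].
have Bc : (b * b'^-1) \isin B by apply: nsubgroupM => //; apply: nsubgroupV.
exists (a * a'^-1); first by apply: nsubgroupM => //; apply: nsubgroupV.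
exists ((b * b'^-1) ^ a'^-1); first exact: nsubgroup_conj.
by rewrite /conjg !invMg invgK -!mulgA mulKg.
Qed.

Lemma mulset_conj A B x y : mulset A B x -> mulset A B (x ^ y).
Proof.
move=> [a Aa [b Bb <-]]; exists (a ^ y); first exact: nsubgroup_conj.
by exists (b ^ y); [apply: nsubgroup_conj | rewrite conjMg].
Qed.

Definition joinN A B : nsubgroup F :=
  NSubgroup (mulset_subgroup A B) (@mulset_conj A B).

Definition trivN : nsubgroup F :=
  @NSubgroup F [set 1] (@subgroup_trivial F)
    (fun x y (x1 : x = 1) => etrans (congr1 (conjg^~ y) x1) (conj1g y)).

Lemma joinNl A B : A `<=` joinN A B.
Proof. by move=> x Ax; exists x => //; exists 1; [apply: nsubgroup1 | rewrite mulg1]. Qed.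

Lemma joinNr A B : B `<=` joinN A B.
Proof. by move=> x Bx; exists 1; [apply: nsubgroup1 | exists x; rewrite ?mul1g]. Qed.

Lemma joinN_sub A B (C : set F) : is_subgroup C -> A `<=` C -> B `<=` C -> joinN A B `<=` C.
Proof.
by move=> sC subAC subBC _ [x Ax [y By <-]]; apply: (subgroupM sC); [apply: subAC | apply: subBC].
Qed.

Lemma joinNA : associative joinN.
Proof.
move=> A B C; apply/nsubgroup_eq/seteqP; split.
  by move=> _ [a Aa [_ [b Bb [c Cc <-]] <-]]; exists (a * b);
     [exists a => //; exists b | exists c; rewrite ?mulgA].
by move=> _ [_ [a Aa [b Bb <-]] [c Cc <-]]; exists a => //;
   exists (b * c); [exists b => //; exists c | rewrite mulgA].
Qed.

Lemma joinN1 : left_id trivN joinN.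
Proof.
move=> A; apply/nsubgroup_eq/seteqP; split; last exact: joinNr.
by apply: joinN_sub => [|_ ->|//]; [apply: nsubgroup_subgroup | apply: nsubgroup1].
Qed.

Lemma joinNr1 : right_id trivN joinN.
Proof.
move=> A; apply/nsubgroup_eq/seteqP; split; last exact: joinNl.
by apply: joinN_sub => [|//|_ ->]; [apply: nsubgroup_subgroup | apply: nsubgroup1].
Qed.

(** With this structure the last factor of an iterated [joinN] can be split off, as the recursion
    for the product of the gamma subgroups requires. *)
HB.instance Definition _ := Monoid.isLaw.Build (nsubgroup F) trivN joinN joinNA joinN1 joinNr1.

Lemma commN_triv : commN trivN = trivN.
Proof.
apply/nsubgroup_eq/seteqP; split; last by move=> _ ->; apply: nsubgroup1.
by apply: commN_sub => [|x y ->]; [apply: nsubgroup_subgroup | rewrite /commg conj1g invg1 mulg1].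
Qed.

End NormalSubgroups.

Section QuotientMap.
Variables (F : groupType) (B : nsubgroup F).

Definition piN (x : F) : quo B := (\pi_(quo B) x)%qT.

HB.instance Definition _ := isMultiplicative.Build F (quo B) piN (@pi_quoM F B).

Lemma piN_eq1 x : piN x = 1 <-> x \isin B.
Proof.
split=> [/esym/eqP/pi_quoP|Bx]; first by rewrite invg1 mul1g.
by apply/esym/eqP/pi_quoP; rewrite invg1 mul1g.
Qed.

Lemma piN_eq x y : piN x = piN y <-> (x^-1 * y) \isin B.
Proof. by split=> [/eqP/pi_quoP|Bxy]; last exact/eqP/pi_quoP. Qed.

Lemma piN_repr (x : quo B) : piN (repr x) = x.
Proof. exact: reprK. Qed.

(** Commutator calculus modulo [B] thus becomes reasoning on commuting elements of [quo B]. *)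
Lemma comm_piN x y : [~ x, y] \isin B <-> commute (piN x) (piN y).
Proof. by rewrite -piN_eq1 -commN_eq1 gmorphR. Qed.

Lemma subquo_subgroup A : is_subgroup A -> is_subgroup (subquo B A).
Proof. exact: (@subgroup_image _ _ (piN : {multiplicative F -> quo B})). Qed.

Lemma quo_lift (H : groupType) (phi : {multiplicative F -> H}) :
  B `<=` kernel phi ->
  exists f : {multiplicative quo B -> H}, forall x, f (piN x) = phi x.
Proof.
move=> Bphi; pose f (x : quo B) := phi (repr x).
have fE x : f (piN x) = phi x.
  have /Bphi /= : ((repr (piN x))^-1 * x) \isin B by apply/piN_eq; rewrite piN_repr.
  by rewrite gmulfM gmorphV => e; apply: (mulgI (phi (repr (piN x)))^-1); rewrite mulVg e.
have fM : {morph f : x y / x * y}.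
  move=> x y; rewrite -[x]piN_repr -[y]piN_repr -gmulfM !fE; apply: gmulfM.
pose fm := isMultiplicative.Build _ _ f fM.
pose g : {multiplicative quo B -> H} := HB.pack f fm.
by exists g.
Qed.

Lemma subquo_kernel (H : groupType) (phi : {multiplicative F -> H})
    (f : {multiplicative quo B -> H}) (A : set F) :
  (forall x, f (piN x) = phi x) ->
  subquo B A `&` kernel f = subquo B (A `&` kernel phi).
Proof.
move=> fE; apply/seteqP; split=> [_ [[x Ax <-] fx]|_ [x [Ax px] <-]].
  by exists x => //; split=> //=; rewrite -fE.
by split; [exists x | rewrite /= -px; apply: fE].
Qed.

Lemma subquo_image (H : groupType) (phi : {multiplicative F -> H})
    (f : {multiplicative quo B -> H}) (A : set F) :
  (forall x, f (piN x) = phi x) -> f @` subquo B A = phi @` A.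
Proof.
move=> fE; apply/seteqP; split=> [_ [_ [x Ax <-] <-]|_ [x Ax <-]].
  by exists x => //; rewrite -fE.
by exists (piN x); [exists x | apply: fE].
Qed.

(** It reduces an inclusion [A, X] <= B to generators of X. *)
Lemma centralizing_subgroup (A : set F) :
  is_subgroup [set g | forall u, A u -> [~ u, g] \isin B].
Proof.
split=> [u _|x y Bx By u Au]; first by rewrite commg1; apply: nsubgroup1.
apply/comm_piN; rewrite gmorphF; apply: commuteM; first exact/comm_piN/Bx.
by apply: commuteV; exact/comm_piN/By.
Qed.

End QuotientMap.

(** * Commutators with the lower central series *)

Section LowerCentral.
Variables (F : groupType) (T : nsubgroup F).

(* The three subgroups lemma in the form
   [T_k, gamma_(n+2)] <= [[T_k, gamma_(n+1)], F] [[T_k, F], gamma_(n+1)]. *)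
Lemma icommN_gamma n k u g : u \isin icommN T k -> g \isin icommN (fullN F) n ->
  [~ u, g] \isin icommN T (k + n.+1).
Proof.
elim: n k u g => [|n IH] k u g Tu; first by rewrite addn1 => _; apply: mem_commN.
move: Tu => /[swap] Fg; move: u; move: g Fg.
change (icommN (fullN F) n.+1 `<=`
  [set g | forall u, u \isin icommN T k -> [~ u, g] \isin icommN T (k + n.+2)]).
apply: commN_sub; first exact: centralizing_subgroup.
move=> g f Fg; set Z := icommN T (k + n.+2) => v Tv.
(* Instead of the Hall-Witt identity, [g * f] and [f * g] are shown to act alike on [u] modulo [Z].
   With a = [u, g] and b = [u, f], the results are u b a and u a b, and [a] and [b] commute modulo
   [Z]. *)
have conjC u : u \isin icommN T k -> piN Z u ^ (piN Z g * piN Z f) = piN Z u ^ (piN Z f * piN Z g).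
  move=> Tu; pose a := [~ u, g]; pose b := [~ u, f].
  have Ta : a \isin icommN T (k + n.+1) by apply: IH.
  have Za h : [~ a, h] \isin Z by rewrite /Z addnS; apply: mem_commN.
  have Tb : b \isin icommN T k.+1 by apply: mem_commN.
  have Zb : [~ b, g] \isin Z by rewrite /Z -addSnnS; apply: IH.
  have /comm_piN caf := Za f; have /comm_piN cab := Za b; move/comm_piN: Zb => cbg.
  have fixJ x y : commute (piN Z x) (piN Z y) -> piN Z x ^ piN Z y = piN Z x.
    by move=> xy; apply/conjg_fixP/commgP.
  have uJ h : piN Z u ^ piN Z h = piN Z u * piN Z [~ u, h].
    by rewrite gmorphR commgEl mulKVg.
  by rewrite !conjgM !uJ !conjMg !uJ (fixJ a f) // (fixJ b g) // -!mulgA -/a -/b cab.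
(* With [v] the conjugate of [u] by [f * g], conjugating [v] by [g, f] gives the conjugate of [u] by
   [g * f], which is [v] again modulo [Z]. *)
have [u Tu vE] : exists2 u, u \isin icommN T k & v = u ^ (f * g).
  by exists (v ^ (f * g)^-1); [apply: nsubgroup_conj | rewrite conjgKV].
apply/piN_eq1; rewrite vE gmorphR gmorphJ gmulfM gmorphR.
by apply/commN_eq1/commgP/conjg_fixP; rewrite -conjgM -commgC conjC.
Qed.

End LowerCentral.

(** * Invariance under the choice of the presentation *)

Lemma equalizer_subgroup (F H : groupType) (f g : {multiplicative F -> H}) :
  is_subgroup [set x | f x = g x].
Proof.
split=> [|x y /= ex ey]; first by rewrite /= !gmorph1.
by rewrite /= !gmorphF ex ey.
Qed.

Lemma icommN_full_sub (F : groupType) (S : nsubgroup F) k :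
  icommN S k `<=` icommN (fullN F) k.
Proof. exact: icommNS. Qed.

(** Write phi y = y z and phi f = f t, with z in T_k by induction and t in T. Modulo T_(k+1), z is
    central, and t commutes with gamma_(k+1)(F), which contains both y and [y, f]. Hence [y z, f t]
    and [y, f] agree. *)
Lemma icommN_congr (F : groupType) (S T : nsubgroup F)
    (phi : {multiplicative F -> F}) k x :
  (forall y, (y^-1 * phi y) \isin T) ->
  x \isin icommN S k -> (x^-1 * phi x) \isin icommN T k.
Proof.
move=> phiT; elim: k x => [|k IH] x; first by move=> _; apply: phiT.
pose Z := icommN T k.+1 => Sx; apply/piN_eq; move: x Sx.
suff : icommN S k.+1 `<=` [set x | piN Z x = (piN Z \o phi) x] by apply.
apply: commN_sub; first exact: (@equalizer_subgroup _ _ (piN Z) (piN Z \o phi)).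
move=> y f Sy /=; have := IH y Sy; set z := y^-1 * _ => Tz.
pose t := f^-1 * phi f; have Tt : t \isin T by apply: phiT.
have -> : phi [~ y, f] = [~ y * z, f * t] by rewrite gmorphR !mulKVg.
have cz h : commute (piN Z z) (piN Z h) by apply/comm_piN; apply: (@mem_commN _ (icommN T k)).
have ct h : h \isin icommN (fullN F) k -> commute (piN Z t) (piN Z h).
  by move=> Fh; apply/comm_piN; apply: (@icommN_gamma _ _ k 0).
have Fy : y \isin icommN (fullN F) k by apply: icommN_full_sub Sy.
have fixJ (u v : quo Z) : commute u v -> u ^ v = u by move=> uv; apply/conjg_fixP/commgP.
have yJ : piN Z y ^ piN Z t = piN Z y by apply/fixJ/commute_sym/ct.
have RJ : piN Z [~ y, f] ^ piN Z t = piN Z [~ y, f].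
  by apply/fixJ/commute_sym/ct/nsubgroupRl.
have zJ : piN Z z ^ piN Z (f * t) = piN Z z by apply: fixJ.
have pM u v : piN Z (u * v) = piN Z u * piN Z v by apply: gmulfM.
have -> : piN Z [~ y * z, f * t] = [~ piN Z (y * z), piN Z (f * t)] by apply: gmorphR.
have yfJ : piN Z y ^ piN Z (f * t) = piN Z y * piN Z [~ y, f].
  have e : piN Z y ^ piN Z f = piN Z y * piN Z [~ y, f].
    by rewrite gmorphR commgEl mulKVg.
  by rewrite (pM f) conjgM e conjMg yJ RJ.
rewrite [RHS]commgEl (pM y) conjMg zJ yfJ -(mulgA (piN Z y)) -(cz [~ y, f]) invMg -mulgA.
by rewrite mulKg mulKg.
Qed.

(** Free groups are projective: the values on a basis are lifted by choice, and the uniqueness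
    clause of [free_on] identifies [f2 \o alpha] with [f1]. *)
Lemma free_lift (F1 F2 H : groupType) (f1 : {multiplicative F1 -> H})
    (f2 : {multiplicative F2 -> H}) :
  is_free F1 -> range f1 `<=` range f2 ->
  exists alpha : {multiplicative F1 -> F2}, forall x, f2 (alpha x) = f1 x.
Proof.
move=> [X freeX] sub12.
have [g gE] : {g : F1 -> F2 & forall x, f2 (g x) = f1 x}.
  apply: (@choice _ _ (fun x y => f2 y = f1 x)) => x.
  by have [|y _ e] := sub12 (f1 x); [exists x | exists y].
have [alpha [alphaX _]] := freeX F2 g; exists alpha => x.
have [beta [_ uniq]] := freeX H f1.
rewrite -[LHS]/((f2 \o alpha) x) (uniq f1) // -(uniq (f2 \o alpha)) //.
by move=> y Xy /=; rewrite alphaX.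
Qed.

Section PresentationInvariance.
Variables (H : groupType) (N : set H).
Variables (F1 F2 : groupType) (f1 : {multiplicative F1 -> H})
  (f2 : {multiplicative F2 -> H}).
Variables (S1 : nsubgroup F1) (S2 : nsubgroup F2).
Hypothesis S1E : S1 = f1 @^-1` N :> set F1.
Hypothesis S2E : S2 = f2 @^-1` N :> set F2.

Lemma icommN_lift (alpha : {multiplicative F1 -> F2}) k x :
  (forall x, f2 (alpha x) = f1 x) ->
  (x \isin icommN S1 k -> alpha x \isin icommN S2 k) /\
  (x \isin icommN (kernel f1) k -> alpha x \isin icommN (kernel f2) k).
Proof.
move=> aE.
have step (A1 : nsubgroup F1) (A2 : nsubgroup F2) :
    A1 `<=` alpha @^-1` A2 -> icommN A1 k `<=` alpha @^-1` icommN A2 k.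
  move=> A12; elim: k => [//|k IH]; apply: (@commN_sub _ (icommN A1 k)).
    by apply: subgroup_preimage; apply: nsubgroup_subgroup.
  move=> u v Au; rewrite /preimage /mkset gmorphR.
  by apply: (@mem_commN _ (icommN A2 k)); apply: (IH u).
split; apply: step => u; last by rewrite /= aE.
by rewrite S1E S2E /= aE.
Qed.

End PresentationInvariance.

(** [multiplier] freed from the record [free_presentation], so that [F] itself can also serve as a
    presentation of G / K. *)
Definition presmult (F H : groupType) (f : {multiplicative F -> H})
    (S : nsubgroup F) (k : nat) : set (quo (icommN (kernel f) k)) :=
  subquo (icommN (kernel f) k) (kernel f `&` icommN S k).

Arguments presmult {F H} f S k _.

(** The map [f] between the whole quotients is in general not an isomorphism, so only its image and
    kernel on the multiplier are recorded. The composite of the two liftings on F2 gives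
    surjectivity, and the one on F1 gives injectivity. *)
Lemma presmult_iso (H : groupType) (N : set H) (F1 F2 : groupType)
    (f1 : {multiplicative F1 -> H}) (f2 : {multiplicative F2 -> H})
    (S1 : nsubgroup F1) (S2 : nsubgroup F2) k :
  is_free F1 -> is_free F2 -> range f1 = range f2 ->
  S1 = f1 @^-1` N :> set F1 -> S2 = f2 @^-1` N :> set F2 ->
  exists f : {multiplicative quo (icommN (kernel f1) k) -> quo (icommN (kernel f2) k)},
    f @` presmult f1 S1 k = presmult f2 S2 k /\
    presmult f1 S1 k `&` kernel f = [set 1].
Proof.
move=> free1 free2 r12 S1E S2E.
have [alpha aE] : exists alpha : {multiplicative F1 -> F2}, forall x, f2 (alpha x) = f1 x.
  by apply: free_lift => //; rewrite r12.
have [beta bE] : exists beta : {multiplicative F2 -> F1}, forall x, f1 (beta x) = f2 x.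
  by apply: free_lift => //; rewrite r12.
have aS x := icommN_lift S1E S2E k x aE.
have bS x := icommN_lift S2E S1E k x bE.
pose phi : {multiplicative F1 -> _} := piN (icommN (kernel f2) k) \o alpha.
have [|f fE] := @quo_lift _ (icommN (kernel f1) k) _ phi.
  by move=> x Rx; apply/piN_eq1/(aS x).2.
have baT x : (x^-1 * (beta \o alpha) x) \isin kernel f1.
  by rewrite /= gmulfM gmorphV bE aE mulVg.
have abT x : (x^-1 * (alpha \o beta) x) \isin kernel f2.
  by rewrite /= gmulfM gmorphV aE bE mulVg.
exists f; rewrite /presmult (subquo_kernel _ fE) (subquo_image _ fE); split.
  apply/seteqP; split=> [_ [x [Rx Sx] <-]|_ [y [Ry Sy] <-]].
    by exists (alpha x) => //; split; [rewrite /= aE | apply: (aS x).1].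
  exists (beta y); first by split; [rewrite /= bE | apply: (bS y).1].
  by apply/esym/piN_eq/(icommN_congr abT Sy).
apply/seteqP; split=> [_ [x [[Rx Sx] px] <-]|_ ->]; last first.
  by exists 1; [split; [split; apply: nsubgroup1 | apply: gmorph1] | apply: (@gmorph1 _ _ (piN _))].
apply/piN_eq1; move/piN_eq1: px => /(bS (alpha x)).2 Rba.
have := nsubgroupM Rba (nsubgroupV (icommN_congr baT Sx)).
by rewrite invMg invgK mulKVg.
Qed.

(** * The tensor power *)

Section TensorLift.
Local Open Scope ring_scope.

Lemma tensor_lift (X Y V : zmodType) (b : X -> Y -> V) :
  (forall y, {morph b^~ y : x x' / x + x'}) ->
  (forall x, {morph b x : y y' / y + y'}) ->
  exists h : tensor X Y -> V, {morph h : s t / s + t} /\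
    forall x y, h (\pi_(tensor X Y) (symbol x y))%qT = b x y.
Proof.
(* [fglift] takes values in a module over [int]; [zmodule V] is [V] with its canonical structure of
   Z-module. *)
move=> bl br; pose g (u : X * Y) : zmodule V := b u.1 u.2.
pose L : {freeg (X * Y)%type / int} -> zmodule V := fglift g.
have LB : {morph L : s t / s - t} by apply: lift_is_additive.
have L0 : L 0 = 0 by rewrite -(subrr 0) LB subrr.
have LN : {morph L : s / - s} by move=> s; rewrite -[- s]add0r LB L0 add0r.
have LD : {morph L : s t / s + t} by move=> s t; rewrite -[t]opprK LB LN !opprK.
have Lsym x y : L (symbol x y) = b x y by rewrite /L /symbol liftU scale1r.
have Lrel s t : s - t \in @bilinear_relations X Y -> L s = L t.
  move=> /asboolP st; apply/eqP; rewrite -subr_eq0 -LB.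
  apply: (st [pred u | L u == 0]); first split.
  - by rewrite inE L0.
  - by move=> u v; rewrite !inE LB => /eqP-> /eqP->; rewrite subrr.
  - have e (u v : V) : u + v - u - v == 0 by rewrite -addrA -opprD subrr.
    by move=> _ [x x' y|x y y']; rewrite inE !LB !Lsym ?bl ?br; apply: e.
pose h (s : tensor X Y) : V := L (repr s).
have hpi s : h (\pi_(tensor X Y) s)%qT = L s.
  by apply: Lrel; rewrite Quotient.idealrBE reprK.
exists h; split=> [s t|x y]; last by rewrite hpi Lsym.
by rewrite -[s]reprK -[t]reprK -raddfD !hpi LD.
Qed.

End TensorLift.

Notation mulpow X := (Algebra.to_multiplicative X).

(** The target need not be abelian: the values of [b] commute pairwise, so the subgroup they
    generate is abelian. It is turned into a [zmodType], to which [tensor_lift] applies. *)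
Lemma tensor_glift (X Y : zmodType) (H : groupType) (b : X -> Y -> H) :
  (forall x x' y, b (x + x')%R y = b x y * b x' y) ->
  (forall x y y', b x (y + y')%R = b x y * b x y') ->
  abelian_set (range (fun u : X * Y => b u.1 u.2)) ->
  exists h : {multiplicative mulpow (tensor X Y) -> H},
    (forall x y, h (\pi_(tensor X Y) (symbol x y))%qT = b x y) /\
    range h `<=` generated (range (fun u : X * Y => b u.1 u.2)).
Proof.
set A := generated _ => bl br cb.
have sA : is_subgroup A by apply: generated_subgroup.
have cA : abelian_set A by apply: abelian_set_generated.
pose V := {x : H | `[<A x>]}.
pose inV x (Ax : A x) : V := exist _ x (asboolT Ax).
have VA (v : V) : A (val v) by apply/asboolP; apply: (valP v).
pose add (u v : V) := inV _ (subgroupM sA (VA u) (VA v)).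
pose opp (u : V) := inV _ (subgroupV sA (VA u)).
have addA : associative add by move=> u v w; apply: val_inj; apply: mulgA.
have addC : commutative add by move=> u v; apply: val_inj; apply: cA.
have add0 : left_id (inV _ (subgroup1 sA)) add by move=> u; apply: val_inj; apply: mul1g.
have addN : left_inverse (inV _ (subgroup1 sA)) opp add.
  by move=> u; apply: val_inj; apply: mulVg.
pose VZ : zmodType := HB.pack V (GRing.isZmodule.Build V addA addC add0 addN).
have Ab x y : A (b x y) by apply: sub_generated; exists (x, y).
pose bV x y : VZ := inV _ (Ab x y).
have [||h [hD hS]] := @tensor_lift X Y VZ bV.
- by move=> y x x'; apply: val_inj; apply: bl.
- by move=> x y y'; apply: val_inj; apply: br.
pose g (s : mulpow (tensor X Y)) : H := val (h s).
have gM : {morph g : s t / s * t} by move=> s t; rewrite /g [h _]hD.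
pose gm : {multiplicative mulpow (tensor X Y) -> H} :=
  HB.pack g (isMultiplicative.Build _ _ g gM).
exists gm; split=> [x y|_ [s _ <-]]; first by rewrite /= /g hS.
exact: VA.
Qed.

Lemma commgMl (G : groupType) (x y z : G) :
  commute [~ x, z] y -> [~ x * y, z] = [~ x, z] * [~ y, z].
Proof.
move=> xzy; rewrite [LHS]commgEl invMg conjMg -mulgA (mulgA x^-1) -commgEl.
by rewrite (mulgA y^-1) -(commuteV xzy) -mulgA -commgEl.
Qed.

Lemma commgMr (G : groupType) (x y z : G) :
  commute [~ x, y] z -> commute [~ x, y] [~ x, z] -> [~ x, y * z] = [~ x, y] * [~ x, z].
Proof.
move=> xyz xyxz; rewrite xyxz [LHS]commgEl conjgM.
have -> : x ^ y = x * [~ x, y] by rewrite commgEl mulKVg.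
have e : [~ x, y] ^ z = [~ x, y] by apply/conjg_fixP/commgP.
by rewrite conjMg e mulgA.
Qed.

Section TensorTower.
Variables (F : groupType) (T : nsubgroup F) (E : nat -> nsubgroup F).
Hypothesis E_sub : forall k, E k `<=` icommN T k.
Hypothesis comm_E : forall k u f, u \isin E k -> [~ u, f] \isin E k.+1.
Hypothesis comm_T : forall k u t, u \isin icommN T k -> t \isin T -> [~ u, t] \isin E k.+1.
Hypothesis sub_E : forall k, icommN T k.+1 `<=` E k.

(** In the application [B] and [Q] are the abelianizations of K and G / K. The map [theta] is a
    plain function because it goes from a multiplicative group to an additive one; its kernel is T
    [F, F]. *)
Variables (B Q : zmodType) (theta : F -> Q).
Hypothesis thetaM : forall x y, theta (x * y) = (theta x + theta y)%R.
Hypothesis theta_surj : forall q, exists x, theta x = q.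
Hypothesis theta_ker : forall x, theta x = 0%R -> x \isin joinN T (commN (fullN F)).

Notation tower k := (iter k (fun X : zmodType => tensor X Q) B).

(** [[T_k, F], F] is T_(k+2), which lies in E_(k+1). Centrality is what makes the commutator
    bilinear modulo E_(k+1). *)
Let central k u f g : u \isin icommN T k ->
  commute (piN (E k.+1) [~ u, f]) (piN (E k.+1) g).
Proof.
by move=> Tu; apply/comm_piN; apply: (sub_E (k := k.+1)); do 2 apply: mem_commN.
Qed.

Let comm_mull k u v f : u \isin icommN T k ->
  piN (E k.+1) [~ u * v, f] = piN (E k.+1) [~ u, f] * piN (E k.+1) [~ v, f].
Proof.
move=> Tu; have c := central f v Tu.
by rewrite !gmorphR gmulfM commgMl // -gmorphR.
Qed.

Let comm_mulr k u f g : u \isin icommN T k ->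
  piN (E k.+1) [~ u, f * g] = piN (E k.+1) [~ u, f] * piN (E k.+1) [~ u, g].
Proof.
move=> Tu; have c := central f g Tu; have c' := central f [~ u, g] Tu.
by rewrite !gmorphR gmulfM commgMr // -!gmorphR.
Qed.

(** The factor of f in T is absorbed by [T_k, T] <= E_(k+1), the one in [F, F] by [T_k, gamma_2(F)]
    <= T_(k+2) <= E_(k+1). *)
Let comm_ker k u f : u \isin icommN T k -> theta f = 0%R -> [~ u, f] \isin E k.+1.
Proof.
move=> Tu /theta_ker; move: u Tu; move: f.
suff : joinN T (commN (fullN F)) `<=`
    [set f | forall u, u \isin icommN T k -> [~ u, f] \isin E k.+1].
  by move=> sub f u Tu /sub; apply.
apply: joinN_sub; first exact: centralizing_subgroup.
  by move=> t Tt u Tu; apply: comm_T.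
move=> f Ff u Tu; apply: (sub_E (k := k.+1)).
by have := icommN_gamma Tu (n := 1) Ff; rewrite addn2.
Qed.

Let comm_congr k u u' f f' : u \isin icommN T k -> u' \isin icommN T k ->
  piN (E k) u = piN (E k) u' -> theta f = theta f' ->
  piN (E k.+1) [~ u, f] = piN (E k.+1) [~ u', f'].
Proof.
move=> Tu Tu' /piN_eq Euu' ff'.
have theta1 : theta 1 = 0%R by apply: (addrI (theta 1)); rewrite -thetaM mulg1 addr0.
have f0 : theta (f^-1 * f') = 0%R by rewrite thetaM -ff' -thetaM mulVg.
have -> : u' = u * (u^-1 * u') by rewrite mulKVg.
have -> : f' = f * (f^-1 * f') by rewrite mulKVg.
rewrite comm_mull // comm_mulr //.
have -> : piN (E k.+1) [~ u, f^-1 * f'] = 1 by apply/piN_eq1/comm_ker.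
have -> : piN (E k.+1) [~ u^-1 * u', f * (f^-1 * f')] = 1 by apply/piN_eq1/comm_E.
by rewrite !mulg1.
Qed.

(** The induction carries a surjection onto T_k / E_k. The pairing is computed on arbitrary
    representatives [r] and [lift]; [comm_congr] makes it independent of them, hence bilinear, and
    makes its values cover the generators of T_(k+1) / E_(k+1). *)
Lemma tensor_tower :
  (exists h : {multiplicative mulpow B -> quo (E 0)}, range h = subquo (E 0) T) ->
  forall k, exists h : {multiplicative mulpow (tower k) -> quo (E k)},
    range h = subquo (E k) (icommN T k).
Proof.
move=> base; elim=> [//|k [h hE]].
have [lift thetaK] : {lift : Q -> F & forall q, theta (lift q) = q}.
  exact: (@choice _ _ (fun q x => theta x = q)).
pose r (x : tower k) := repr (h x).
have rK x : piN (E k) (r x) = h x by apply: piN_repr.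
have Tr x : r x \isin icommN T k.
  have [u Tu e] : subquo (E k) (icommN T k) (h x) by rewrite -hE; exists x.
  have /piN_eq Eur : piN (E k) u = piN (E k) (r x) by rewrite rK.
  by rewrite -(mulKVg u (r x)); apply: nsubgroupM => //; apply: E_sub.
pose b (x : tower k) (q : Q) := piN (E k.+1) [~ r x, lift q].
have bl x x' q : b (x + x')%R q = b x q * b x' q.
  rewrite /b -comm_mull //; apply: comm_congr => //; first exact: nsubgroupM.
  by rewrite gmulfM /= !rK; exact: (@gmulfM _ _ h x x').
have br x q q' : b x (q + q')%R = b x q * b x q'.
  by rewrite /b -comm_mulr //; apply: comm_congr => //; rewrite thetaM !thetaK.
have [//|//||h' [h'E h'S]] := @tensor_glift _ _ _ b.
  by move=> _ _ [[x q] _ <-] [[x' q'] _ <-]; apply: central.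
exists h'; apply/seteqP; split.
  apply: (subset_trans h'S); apply: generated_sub.
    by apply: subquo_subgroup; apply: nsubgroup_subgroup.
  by move=> _ [[x q] _ <-]; exists [~ r x, lift q] => //; apply: mem_commN.
suff sub : icommN T k.+1 `<=` piN (E k.+1) @^-1` range h'.
  by move=> _ [u Tu <-]; apply: (sub u).
apply: (@commN_sub _ (icommN T k)).
  by apply: subgroup_preimage; apply: subgroup_image.
move=> u f Tu.
have [x _ hx] : range h (piN (E k) u) by rewrite hE; exists u.
exists (\pi_(tensor _ _) (symbol x (theta f)))%qT => //.
by rewrite h'E /b; apply: comm_congr => //; rewrite rK.
Qed.

End TensorTower.

(** * The product of the gamma_(k+1)(T, F)_i *)

Section GammaProduct.
Variable F : groupType.
Implicit Types R T A B : nsubgroup F.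

(** Modulo [A, F] [B, F] both factors are central, hence so is their product. *)
Lemma commN_join A B : commN (joinN A B) = joinN (commN A) (commN B).
Proof.
apply/nsubgroup_eq/seteqP; split; last first.
  apply: joinN_sub; first exact: nsubgroup_subgroup.
    by apply: commNS; apply: joinNl.
  by apply: commNS; apply: joinNr.
apply: commN_sub; first exact: nsubgroup_subgroup.
move=> _ f [x Ax [y By <-]]; set Z := joinN _ _.
apply/comm_piN; rewrite gmulfM; apply/commute_sym/commuteM; apply/commute_sym/comm_piN.
  by apply: (@joinNl _ (commN A)); apply: mem_commN.
by apply: (@joinNr _ _ (commN B)); apply: mem_commN.
Qed.

Definition gammaN k T i : nsubgroup F :=
  foldl (@commNN F) T [seq (if j == i then T else fullN F) | j <- iota 2 k].

Lemma gammaNE k T i : gammaN k T i = gammai k T i :> set F.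
Proof.
rewrite /gammaN /gammai.
have e s A : foldl (@commNN F) A s = foldl (@commsub F) A (map (@nsubgroup_set F) s) :> set F.
  by elim: s A => //= B s IH A; rewrite IH.
rewrite e -map_comp; congr foldl; apply: eq_map => j /=.
by case: ifP.
Qed.

Lemma gammaN_rcons k T i :
  gammaN k.+1 T i = commNN (gammaN k T i) (if i == k.+2 then T else fullN F).
Proof.
have e : iota 2 k.+1 = rcons (iota 2 k) k.+2 by rewrite -(addn1 k) iotaD cats1 add2n addn1.
by rewrite /gammaN e map_rcons foldl_rcons eq_sym.
Qed.

Lemma gammaNS k T i : i != k.+2 -> gammaN k.+1 T i = commN (gammaN k T i).
Proof. by move=> ik; rewrite gammaN_rcons (negPf ik) commNN_full. Qed.

(** The positions filled after the first are 2, ..., k + 1, so a larger index never places a second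
    [T]. *)
Lemma gammaN_out k m T : (k.+1 < m)%N -> gammaN k T m = icommN T k.
Proof.
elim: k => [//|k IH] km; rewrite gammaNS ?IH //; last by rewrite neq_ltn km orbT.
exact: ltnW.
Qed.

Lemma gammaN_last k T : gammaN k.+1 T k.+2 = commNN (icommN T k) T.
Proof. by rewrite gammaN_rcons eqxx gammaN_out. Qed.

(** The E_k of the overview in closed form; [gammaprod0] and [gammaprodS] recover the recursion. *)
Definition gammaprod R T k : nsubgroup F :=
  joinN (icommN R k) (\big[@joinN F/trivN F]_(2 <= i < k.+2) gammaN k T i).

Lemma gammaprod0 R T : gammaprod R T 0 = R.
Proof. by rewrite /gammaprod big_geq // joinNr1. Qed.

(** One more bracket with F turns the factors of index at most k + 1 into those of the next level.
    The only new factor has index k + 2 and equals [T_k, T]. *)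
Lemma gammaprodS R T k :
  gammaprod R T k.+1 = joinN (commN (gammaprod R T k)) (commNN (icommN T k) T).
Proof.
rewrite /gammaprod big_nat_recr //= gammaN_last joinNA commN_join; congr joinN.
congr joinN; rewrite (big_morph _ commN_join (@commN_triv F)).
by apply: eq_big_nat => i /andP[_ ik]; rewrite gammaNS // neq_ltn ik.
Qed.

Lemma gammaprodE R T k : gammaprod R T k =
  mulset (icommsub R setT k) (\big[@mulset F/[set 1]]_(2 <= i < k.+2) gammai k T i) :> set F.
Proof.
rewrite /= icommNE; congr mulset.
rewrite (@big_morph _ _ (@nsubgroup_set F) [set 1] (@mulset F)) //.
by apply: eq_bigr => i _; apply: gammaNE.
Qed.

Lemma sub_gammaprod R T k : icommN R k `<=` gammaprod R T k.
Proof. exact: joinNl. Qed.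

Lemma comm_gammaprod R T k u f :
  u \isin gammaprod R T k -> [~ u, f] \isin gammaprod R T k.+1.
Proof. by move=> Eu; rewrite gammaprodS; apply: (@joinNl _ (commN _)); apply: mem_commN. Qed.

Lemma comm_gammaprod_last R T k u t :
  u \isin icommN T k -> t \isin T -> [~ u, t] \isin gammaprod R T k.+1.
Proof.
move=> Tu Tt; rewrite gammaprodS; apply: (@joinNr _ _ (commNN _ T)).
exact: mem_commNN.
Qed.

Lemma gammaprod_sub R T k : R `<=` T -> gammaprod R T k `<=` icommN T k.
Proof.
move=> RT; elim: k => [|k IH]; first by rewrite gammaprod0.
rewrite gammaprodS; apply: joinN_sub; first exact: nsubgroup_subgroup.
  exact: commNS.
apply: commNN_sub => [|x y Tx _]; first exact: nsubgroup_subgroup.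
exact: mem_commN.
Qed.

Lemma icommN_sub_gammaprod R T k : commN T `<=` R -> icommN T k.+1 `<=` gammaprod R T k.
Proof. by move=> TR; rewrite icommNSr => x /(icommNS TR); apply: sub_gammaprod. Qed.

End GammaProduct.

(** * Subgroups of a finite group seen as sets *)

Section Generated.
Variable gT : finGroupType.

Lemma generatedE (A : {set gT}) : generated [set` A] = [set` <<A>>].
Proof.
apply/seteqP; split.
  apply: generated_sub; last by move=> x /= xA; apply: mem_gen.
  split=> [|x y /= xA yA]; first exact: group1.
  by rewrite groupM ?groupV.
pose B := [set x | `[< generated [set` A] x >]]%SET.
have sA : is_subgroup (generated [set` A]) by apply: generated_subgroup.
have inB x : x \in B <-> generated [set` A] x.
  by rewrite /B finset.inE; split=> /asboolP.
have gB : group_set B.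
  apply/group_setP; split; first by apply/inB; apply: sA.1.
  by move=> x y /inB Ax /inB Ay; apply/inB; exact: (subgroupM sA Ax Ay).
have AB : <<A>> \subset group gB.
  rewrite gen_subG; apply/fintype.subsetP => x xA; apply/inB.
  exact: sub_generated.
by move=> x /= /(fintype.subsetP AB) /inB.
Qed.

Lemma commsubE (A B : {set gT}) : commsub [set` A] [set` B] = [set` [~: A, B]].
Proof.
rewrite /commsub /commutator -generatedE; congr generated; apply/seteqP; split.
  by move=> _ [x xA [y yB <-]]; apply: imset2_f.
by move=> _ /= /imset2P[x y xA yB ->]; exists x => //; exists y.
Qed.

Lemma ncard_set (A : {set gT}) : ncard [set` A] = #|A|.
Proof.
rewrite /ncard; have -> : [set` A] = [set` [fset x in enum A]%fset].
  by apply/seteqP; split=> x /=; rewrite !inE mem_enum.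
by rewrite set_fsetK card_fseq undup_id ?enum_uniq // cardE.
Qed.

Lemma fcomm_central (K G : {group gT}) c :
  K \subset 'Z(G) -> (0 < c)%N -> fcomm K G c = 1%g.
Proof.
case: c => // c; rewrite finset.subsetI => /andP[_ cKG] _.
elim: c => [|c IH]; first exact/commG1P.
by rewrite /fcomm iterS -/(fcomm K G c.+1) IH comm1G.
Qed.

End Generated.

(** * The central subgroup K *)

Section Presentation.
Variables (gT : finGroupType) (G : {group gT}) (F : groupType).
Variables (p : {multiplicative F -> gT}).
Hypothesis p_range : range p = [set` G].

Lemma presentation_in x : p x \in G.
Proof. by have : range p (p x) by [exists x]; rewrite p_range. Qed.

Lemma presentation_onto g : g \in G -> exists x, p x = g.
Proof. by move=> gG; have : [set` G] g by []; rewrite -p_range => -[x _]; exists x. Qed.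

Lemma preim_subgroup (N : {group gT}) : is_subgroup (p @^-1` [set` N]).
Proof.
apply: subgroup_preimage; split=> [|x y /= xN yN]; first exact: group1.
by rewrite groupM ?groupV.
Qed.

Lemma preim_conj (N : {group gT}) : G \subset 'N(N) ->
  forall x y, (p @^-1` [set` N]) x -> (p @^-1` [set` N]) (x ^ y).
Proof.
move=> nNG x y /= xN; rewrite gmorphJ memJ_norm //.
exact: (fintype.subsetP nNG) (presentation_in y).
Qed.

Definition preimN (N : {group gT}) (nNG : G \subset 'N(N)) : nsubgroup F :=
  NSubgroup (preim_subgroup N) (preim_conj nNG).

Lemma icommN_preim_image (N : {group gT}) (nNG : G \subset 'N(N)) c :
  N \subset G -> p @` icommN (preimN nNG) c = [set` fcomm N G c].
Proof.
move=> NG; elim: c => [|c IH].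
  apply/seteqP; split=> [_ [x xN <-]//|g /= gN].
  have [x px] := presentation_onto (fintype.subsetP NG _ gN).
  by exists x => //=; rewrite px.
have -> : p @` icommN (preimN nNG) c.+1 = commsub (p @` icommN (preimN nNG) c) (p @` setT).
  by rewrite -commsub_image.
by rewrite IH p_range commsubE.
Qed.

Variables (K : {group gT}) (nKG : G \subset 'N(K)).

Definition quo_presentation (x : F) : coset_of K := coset K (p x).

(** [coset K] is multiplicative only on the normalizer of [K], which contains the range of [p]. *)
Lemma quo_presentationM : {morph quo_presentation : x y / x * y}.
Proof.
by move=> x y; rewrite /quo_presentation gmulfM morphM //;
   apply: (fintype.subsetP nKG); apply: presentation_in.
Qed.

End Presentation.

(** As [rho] is onto, [H, H] is the image of [F, F], so [x] agrees with an element of [F, F] up to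
    the kernel. *)
Lemma abelianization_kernel (F H : groupType) (rho : {multiplicative F -> H}) x :
  range rho = setT -> rho x \isin commN (fullN H) ->
  x \isin joinN (kernel rho) (commN (fullN F)).
Proof.
move=> rT Hx; have : (rho @` commsub setT setT) (rho x) by rewrite commsub_image rT.
move=> [w Fw e]; exists (x * w^-1).
  by rewrite /= gmorphF e mulgV.
by exists w; rewrite ?mulgVK.
Qed.

Section CentralSubgroup.
Variables (c : nat) (hc : (1 <= c)%N) (gT : finGroupType) (G N K : {group gT}).
Hypotheses (nNG : N <| G) (cKG : K \subset 'Z(G)) (sKN : K \subset N).
Variables (F : groupType) (p : {multiplicative F -> gT}).
Hypothesis p_range : range p = [set` G].
Variable T : nsubgroup F.
Hypotheses (sRT : kernel p `<=` T) (TK : p @` T = [set` K]).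

Notation R := (kernel p).
Notation Rc := (icommN R c).
Notation Tc := (icommN T c).
Notation Ec := (gammaprod R T c).
Notation S := (preimN p_range (normal_norm nNG)).
Notation M := (subquo Rc (R `&` icommN S c)).
Notation MT := (subquo Tc (T `&` icommN S c)).
Notation I := (subquo Tc (R `&` icommN S c)).
Notation L := (subquo Rc Tc).
Notation tens := [set: tensor_power c (subg_of K) (subg_of (G / K)%G)].

Lemma mem_preim_central x : (x \isin T) <-> p x \in K.
Proof.
split=> [Tx|xK]; first by have : (p @` T) (p x) by [exists x]; rewrite TK.
have : [set` K] (p x) by [].
rewrite -TK => -[t Tt e]; rewrite -(mulKVg t x); apply: nsubgroupM => //.
by apply: sRT; rewrite /= gmulfM gmorphV e mulVg.
Qed.

Lemma commN_preim_central : commN T `<=` R.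
Proof.
apply: commN_sub; first exact: nsubgroup_subgroup.
move=> x y /mem_preim_central xK; rewrite /= gmorphR; apply/commN_eq1.
have /centerP[_ cx] := fintype.subsetP cKG _ xK.
by apply: cx; apply: presentation_in.
Qed.

Lemma icommN_preim_central : Tc `<=` R.
Proof.
by case: c hc => // c' _ x; rewrite icommNSr => /icommN_subset /commN_preim_central.
Qed.

Lemma icommN_preim_sub : Tc `<=` icommN S c.
Proof. by apply: icommNS => x /mem_preim_central /= /(fintype.subsetP sKN). Qed.

Lemma multiplier_extension :
  [/\ ncard M = (ncard I * ncard L)%N, (ngen M <= ngen I + ngen L)%E &
      (expo M %| expo I * expo L)%N].
Proof.
have [|f fE] := @quo_lift _ Rc _ (piN Tc).
  by move=> x /(icommNS sRT) Tx; apply/piN_eq1.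
have kerE : M `&` kernel f = L.
  rewrite (subquo_kernel _ fE); congr subquo; apply/seteqP; split=> x.
    by move=> [_ /piN_eq1].
  move=> Tx; split; last exact/piN_eq1.
  by split; [apply: icommN_preim_central | apply: icommN_preim_sub].
have sM : is_subgroup M.
  by apply: subquo_subgroup; apply: subgroupI; apply: nsubgroup_subgroup.
have imE : f @` M = I by apply: subquo_image fE.
rewrite -kerE -imE; split.
- exact: ncard_image_kernel.
- exact: ngen_image_kernel.
- exact: expo_image_kernel.
Qed.

(** The extension of T_c / E_c by E_c / R_c; the kernel is the third factor of the theorem by
    [gammaprodE]. *)
Lemma kernel_extension :
  let Gam := gamma_quo c R T in let A := subquo Ec Tc in
  [/\ ncard L = (ncard A * ncard Gam)%N, (ngen L <= ngen A + ngen Gam)%E &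
      (expo L %| expo A * expo Gam)%N].
Proof.
move=> Gam A; have [|f fE] := @quo_lift _ Rc _ (piN Ec).
  by move=> x /(@sub_gammaprod _ _ T) Ex; apply/piN_eq1.
have kerE : L `&` kernel f = Gam.
  rewrite (subquo_kernel _ fE) /Gam /gamma_quo -gammaprodE; congr subquo.
  apply/seteqP; split=> x; first by move=> [_ /piN_eq1].
  by move=> Ex; split; [apply: (gammaprod_sub sRT) | apply/piN_eq1].
have sL : is_subgroup L by apply: subquo_subgroup; apply: nsubgroup_subgroup.
have imE : f @` L = A by apply: subquo_image fE.
rewrite -kerE -imE; split.
- exact: ncard_image_kernel.
- exact: ngen_image_kernel.
- exact: expo_image_kernel.
Qed.

Lemma ncard_quotient_multiplier : ncard MT = (#|K :&: fcomm N G c| * ncard I)%N.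
Proof.
have [|f fE] := @quo_lift _ Tc _ p; first exact: icommN_preim_central.
have sMT : is_subgroup MT.
  by apply: subquo_subgroup; apply: subgroupI; apply: nsubgroup_subgroup.
rewrite (ncard_image_kernel f sMT) (subquo_image _ fE) (subquo_kernel _ fE).
congr muln; last first.
  congr ncard; congr subquo; apply/seteqP; split=> x; first by move=> [[_ Sx] Rx].
  by move=> [Rx Sx]; split=> //; split=> //; apply: sRT.
rewrite -ncard_set; congr ncard.
have im := icommN_preim_image p_range (normal_norm nNG) c (normal_sub nNG).
apply/seteqP; split=> [_ [x [/mem_preim_central xK Sx] <-]|g /=].
  rewrite /= finset.inE xK /=.
  have : (p @` icommN S c) (p x) by exists x.
  by rewrite im.
rewrite finset.inE => /andP[gK gN].
have : [set` fcomm N G c] g by [].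
rewrite -im => -[x Sx e]; exists x => //; split=> //.
by apply/mem_preim_central; rewrite e.
Qed.

(** The ambient group is abelian because [T, S_c] <= [T, gamma_(c+1)(F)] <= T_(c+1) <= T_c. *)
Lemma ngen_image_multiplier : (ngen I <= ngen MT)%E.
Proof.
apply: ngen_abelian_subset; last first.
- by move=> _ [x [Rx Sx] <-]; exists x => //; split=> //; apply: sRT.
- by apply: subquo_subgroup; apply: subgroupI; apply: nsubgroup_subgroup.
move=> _ _ [x [Tx _] <-] [y [_ Sy] <-]; apply/comm_piN.
apply: icommN_decr; apply: (@icommN_gamma _ _ c 0) => //.
exact: icommN_full_sub Sy.
Qed.

Lemma expo_image_multiplier : (expo I %| expo MT)%N.
Proof.
apply: expo_subset => _ [x [Rx Sx] <-]; exists x => //; split=> //.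
exact: sRT.
Qed.

Let nKG : G \subset 'N(K).
Proof. by rewrite cents_norm // centsC; exact: fintype.subset_trans cKG (finset.subsetIr _ _). Qed.

Let cos := quo_presentation p K.

Let cosM : {morph cos : x y / x * y} := quo_presentationM p_range nKG.

HB.instance Definition _ := isMultiplicative.Build F (coset_of K) cos cosM.

(** Hence the same free group presents G / K, with [T] as its relators. *)
Lemma kernel_quo_presentation : T = kernel cos.
Proof.
apply/nsubgroup_eq/seteqP; split=> x.
  by move=> /mem_preim_central xK; apply: coset_id.
move=> e; apply/mem_preim_central; apply: coset_idr e.
by apply: (fintype.subsetP nKG); apply: presentation_in.
Qed.

Lemma quo_presentation_range : range cos = [set` (G / K)%G].
Proof.
apply/seteqP; split=> [_ [x _ <-]|g /=].
  by apply: mem_quotient; apply: presentation_in.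
move=> /morphimP[y _ yG ->].
have [x <-] := presentation_onto p_range yG; by exists x.
Qed.

(** The type [coset_of K] may be larger than G / K. Landing in [subg_of] makes the map onto a whole
    type, as [abelianization] requires. *)
Let rho x : subg_of (G / K)%G := subg (G / K)%G (cos x).

Let rhoM : {morph rho : x y / x * y}.
Proof.
move=> x y; rewrite /rho gmulfM subgM //.
  by have : range cos (cos x) by [exists x]; rewrite quo_presentation_range.
by have : range cos (cos y) by [exists y]; rewrite quo_presentation_range.
Qed.

HB.instance Definition _ := isMultiplicative.Build F (subg_of (G / K)%G) rho rhoM.

Let rho_range : range rho = setT.
Proof.
apply/seteqP; split=> // g _.
have : [set` (G / K)%G] (sgval g) by apply: subgP.
by rewrite -quo_presentation_range => -[x _ e]; exists x => //; rewrite /= /rho e sgvalK.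
Qed.

Let rho_kernel x : rho x = 1 -> x \isin T.
Proof.
move=> e; rewrite kernel_quo_presentation /=.
have : range cos (cos x) by exists x.
rewrite quo_presentation_range => /= xG.
by rewrite -[LHS](@subgK _ _ _ xG) -/(rho x) e.
Qed.

(** Preimages in [F] of elements of K are multiplicative modulo E_0 = R, and the resulting map
    factors through the abelianization because K is central, hence abelian. *)
Let base : exists h : {multiplicative mulpow (abelianization (subg_of K)) -> quo (gammaprod R T 0)},
  range h = subquo (gammaprod R T 0) T.
Proof.
have [s sE] : {s : subg_of K -> F & forall k, p (s k) = sgval k}.
  apply: (@choice _ _ (fun k x => p x = sgval k)) => k.
  apply: (presentation_onto p_range).
  exact: (fintype.subsetP (fintype.subset_trans cKG (center_sub G)) _ (subgP k)).
pose phi k := piN (gammaprod R T 0) (s k).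
have phiM : {morph phi : x y / x * y}.
  move=> x y; rewrite /phi -gmulfM; apply/piN_eq; rewrite gammaprod0 /=.
  by rewrite !gmulfM gmorphV !sE; apply: mulVg.
pose phim : {multiplicative subg_of K -> quo (gammaprod R T 0)} :=
  HB.pack phi (isMultiplicative.Build _ _ phi phiM).
have [|h hE] := @quo_lift _ (commN (fullN (subg_of K))) _ phim.
  apply: commN_sub; first exact: nsubgroup_subgroup.
  move=> x y _; change (phim [~ x, y] = 1); rewrite gmorphR; apply/commN_eq1.
  rewrite /commute -!gmulfM; congr (phim _); apply: val_inj.
  have /centerP[_ cx] := fintype.subsetP cKG _ (subgP x).
  apply: cx; exact: (fintype.subsetP (fintype.subset_trans cKG (center_sub G)) _ (subgP y)).
pose g (x : mulpow (abelianization (subg_of K))) := h x.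
have gM : {morph g : x y / x * y} by move=> x y; apply: (@gmulfM _ _ h x y).
pose gm : {multiplicative mulpow (abelianization (subg_of K)) -> quo (gammaprod R T 0)} :=
  HB.pack g (isMultiplicative.Build _ _ g gM).
exists gm.
apply/seteqP; split=> [_ [x _ <-]|_ [x Tx <-]].
  rewrite /= /g -[x]piN_repr hE; exists (s (repr x)) => //.
  by apply/mem_preim_central; rewrite sE; apply: subgP.
exists (piN (commN (fullN (subg_of K))) (subg K (p x))) => //.
rewrite /= /g hE; apply/piN_eq; rewrite gammaprod0 /= gmulfM gmorphV sE subgK ?mulVg //.
exact/mem_preim_central.
Qed.

Lemma tensor_power_onto :
  exists h : {multiplicative tensor_power c (subg_of K) (subg_of (G / K)%G) -> quo Ec},
    range h = subquo Ec Tc.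
Proof.
pose theta (x : F) : abelianization (subg_of (G / K)%G) :=
  piN (commN (fullN (subg_of (G / K)%G))) (rho x).
apply: (@tensor_tower _ T (gammaprod R T) _ _ _ _ _ _ theta) => //.
- by move=> k; apply: gammaprod_sub.
- by move=> k u f; apply: comm_gammaprod.
- by move=> k u t; apply: comm_gammaprod_last.
- by move=> k; apply: icommN_sub_gammaprod; apply: commN_preim_central.
- by move=> x y; rewrite /theta !gmulfM.
- move=> q; have [y _ e] : range rho (repr q) by rewrite rho_range.
  by exists y; rewrite /theta e piN_repr.
- move=> x /piN_eq1 /(abelianization_kernel rho_range) [y Ry [w Fw <-]].
  by exists y; [apply: rho_kernel | exists w].
Qed.

Lemma presentation_quo (Q : free_presentation (G / K)%G) : is_free F ->
  exists f : {multiplicative quo Tc -> quo (icommN (relators Q) c)},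
    f @` MT = multiplier Q c (N / K)%G /\ MT `&` kernel f = [set 1].
Proof.
move=> freeF; rewrite kernel_quo_presentation.
have nNKG : (G / K)%G \subset 'N((N / K)%G) by apply: normal_norm; apply: quotient_normal.
have nKN : K <| N.
  by apply: normalS sKN (normal_sub nNG) _; apply: sub_center_normal.
have [|||f fE] := @presmult_iso _ [set` (N / K)%G] _ _ cos (pres_map Q) S
   (preimN (pres_range Q) nNKG) c freeF (pres_free Q).
- by rewrite quo_presentation_range (pres_range Q).
(* Since K <= N, the preimage of N in F is also the preimage of N / K. *)
- apply/seteqP; split=> x /= xN; first exact: mem_quotient.
  have : p x \in coset K @*^-1 (N / K).
    rewrite mem_morphpre //; apply: (fintype.subsetP nKG); exact: presentation_in.
  by rewrite quotientGK.
- by [].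
by exists f; move: fE; rewrite /presmult /multiplier (icommNE (preimN (pres_range Q) nNKG)).
Qed.

End CentralSubgroup.

(* [T] is a subgroup of the free group of [P] with T / R = K, R = relators P.
   M^(c)(G / K, N / K) is taken with respect to an arbitrary free presentation
   [Q] of G / K.  The quotient %/ is exact: [K, _c G] <= K :&: [N, _c G]. *)
Theorem theorem3p4 (c : nat) (hc : (1 <= c)%N)
  (gT : finGroupType) (G N K : {group gT})
  (nNG : N <| G) (cKG : K \subset 'Z(G)) (sKN : K \subset N)
  (P : free_presentation G) (T : nsubgroup P)
  (sRT : relators P `<=` T) (TK : pres_map P @` T = [set` K])
  (Q : free_presentation (G / K)%G) :
  let M := multiplier P c N in
  let MK := multiplier Q c (N / K)%G in
  let tens := [set: tensor_power c (subg_of K) (subg_of (G / K)%G)] in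
  let Gam := gamma_quo c (relators P) T in
  [/\ (#|K :&: fcomm N G c| %/ #|fcomm K G c| * ncard M
         %| ncard MK * ncard tens * ncard Gam)%N,
      (ngen M <= ngen MK + ngen tens + ngen Gam)%E
    & (expo M %| expo MK * expo tens * expo Gam)%N].
Proof.
move=> M MK tens Gam.
have ME : M = subquo (icommN (relators P) c)
    (relators P `&` icommN (preimN (pres_range P) (normal_norm nNG)) c).
  by rewrite icommNE.
have [f [fE kerfE]] := presentation_quo c nNG cKG sKN (pres_range P) sRT TK Q (pres_free P).
have [h hE] := tensor_power_onto c cKG (pres_range P) sRT TK.
have [M1 M2 M3] := multiplier_extension hc nNG cKG sKN (pres_range P) sRT TK.
have [L1 L2 L3] := kernel_extension c sRT.
have MT1 := ncard_quotient_multiplier hc nNG cKG (pres_range P) sRT TK.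
have I2 := ngen_image_multiplier c nNG (pres_range P) sRT.
have I3 := expo_image_multiplier c nNG (pres_range P) sRT.
rewrite -ME in M1 M2 M3; rewrite -/Gam in L1 L2 L3.
move: fE kerfE MT1 I2 I3; set MT := subquo _ (T `&` _) => fE kerfE MT1 I2 I3.
have sMT : is_subgroup MT.
  by apply: subquo_subgroup; apply: subgroupI; apply: nsubgroup_subgroup.
have sT : is_subgroup tens by [].
split.
- have -> : #|fcomm K G c| = 1%N by rewrite fcomm_central //; apply: finset.cards1.
  (* The factor |K /\ [N, _c G]| |I| is the order of [MT], so the left side becomes |MT| |L|, and
     [MT] is isomorphic to [MK] through [f]. *)
  rewrite divn1 M1 mulnA -MT1.
  rewrite (ncard_image_kernel f sMT) fE kerfE ncard_trivial muln1 -mulnA.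
  by rewrite L1 dvdn_mul // dvdn_mul // -hE; apply: ncard_image_dvd.
- apply: (le_trans M2); rewrite -addeA; apply: leeD.
    apply: (le_trans I2); apply: (le_trans (ngen_image_kernel f sMT)).
    by rewrite fE kerfE ngen_trivial adde0.
  apply: (le_trans L2); apply: leeD => //.
  by rewrite -hE; apply: ngen_image_le.
- apply: (dvdn_trans M3); rewrite -mulnA; apply: dvdn_mul.
    apply: (dvdn_trans I3); apply: (dvdn_trans (expo_image_kernel f sMT)).
    by rewrite fE kerfE expo_trivial muln1.
  apply: (dvdn_trans L3); apply: dvdn_mul => //.
  by rewrite -hE; apply: expo_image_dvd.
Qed.
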